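(* Let $2\le k<n$, let $\Omega\Subset\mathbb R^n$ be a smooth bounded domain, strictly star-shaped with respect to the origin (so $0\in\Omega$), with strictly $(k-1)$-convex boundary, and let $E=\mathbb R^n\setminus\overline\Omega$. Let $\mu(x)=\inf\{s>0:x\in s\Omega\}$, $x\in\mathbb R^n\setminus\{0\}$. Then there exists $T_*>0$ such that the function $$\Psi(x)=\frac{e^{T_*(\mu(x)-1)}-1}{T_*}$$ is smooth in $E$, vanishes on $\partial\Omega$, is positive in $E$, and satisfies $D^2\Psi\in\Gamma_k$ throughout $E$.
   Context: $\sigma_j$ is the $j$-th elementary symmetric function, $\Gamma_j=\{\lambda\in\mathbb R^m:\sigma_i(\lambda)>0,\ 1\le i\le j\}$, and for a symmetric matrix $A$, $A\in\Gamma_j$ means that its eigenvalue vector lies in $\Gamma_j$. $\Omega$ is strictly star-shaped with respect to $0\in\Omega$ if $x\cdot\nu(x)>0$ on $\partial\Omega$, with $\nu$ the unit outward normal. $\partial\Omega$ is strictly $j$-convex if its principal curvature vector (positive for round spheres) lies in $\Gamma_j\subset\mathbb R^{n-1}$ at every point. *)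

(* Defs.v *)
(* Points of R^n are row vectors; the topology of the sup norm on them is the
   usual one, and Euclidean lengths are computed with [dot]. *)
From mathcomp Require Export all_boot all_order all_algebra.
From mathcomp Require Export all_classical all_reals all_analysis.
Export Order.TTheory GRing.Theory Num.Theory.
Export numFieldNormedType.Exports.

Set Implicit Arguments.
Unset Strict Implicit.
Unset Printing Implicit Defensive.

Local Open Scope classical_set_scope.
Local Open Scope ring_scope.

Section ElementarySymmetric.
Context {R : realType}.

Definition esym m (j : nat) (l : 'rV[R]_m) : R :=
  \sum_(A : {set 'I_m} | #|A| == j) \prod_(i in A) l 0 i.

Definition Gamma m (j : nat) : set 'rV[R]_m :=
  [set l | forall i, (1 <= i <= j)%N -> 0 < esym i l].

(* The entries of [l] are the eigenvalues of [A], listed in some order with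
   algebraic multiplicity; [esym] and [Gamma] do not depend on the order. *)
Definition eigenvalue_vector m (A : 'M[R]_m) (l : 'rV[R]_m) : Prop :=
  char_poly A = \prod_(i < m) ('X - (l 0 i)%:P).

Definition mxGamma m (j : nat) : set 'M[R]_m :=
  [set A | A^T = A /\ exists2 l, eigenvalue_vector A l & Gamma j l].

End ElementarySymmetric.

Section Smoothness.
Context {R : realType} {n : nat}.
Implicit Types (f : 'rV[R]_n -> R) (U : set 'rV[R]_n).

Definition dot (u v : 'rV[R]_n) : R := \sum_i u 0 i * v 0 i.

Definition pderiv (i : 'I_n) f : 'rV[R]_n -> R :=
  fun x => 'D_(delta_mx 0 i) f x.

Definition pderivs (s : seq 'I_n) f : 'rV[R]_n -> R := foldr pderiv f s.

(* C^infinity on an open set [U]: all iterated partial derivatives exist and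
   are continuous on [U].  The values of [f] outside [U] play no role. *)
Definition smooth_on U f : Prop :=
  forall (s : seq 'I_n) (x : 'rV[R]_n), U x ->
    {for x, continuous (pderivs s f)} /\
    forall i, derivable (pderivs s f) x (delta_mx 0 i).

Definition gradient f (x : 'rV[R]_n) : 'rV[R]_n := \row_i pderiv i f x.

Definition hessian f (x : 'rV[R]_n) : 'M[R]_n :=
  \matrix_(i, j) pderiv i (pderiv j f) x.

End Smoothness.

Section Domains.
Context {R : realType} {n : nat}.
Implicit Types (Omega U : set 'rV[R]_n) (p x v : 'rV[R]_n).
Implicit Types rho : 'rV[R]_n -> R.

Definition boundary Omega : set 'rV[R]_n := closure Omega `\` interior Omega.

Definition local_defining Omega p U rho : Prop :=
  [/\ open U, U p, smooth_on U rho,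
      (forall x, U x -> gradient rho x != 0) &
      (forall x, U x -> Omega x <-> rho x < 0)].

Definition smooth_bounded_domain Omega : Prop :=
  [/\ open Omega, connected Omega, Omega !=set0, bounded_set Omega &
      forall p, boundary Omega p -> exists U rho, local_defining Omega p U rho].

(* On the boundary this is the outward unit normal when [rho] is a local
   defining function (rho < 0 inside); off the boundary it is a smooth
   extension of the normal field. *)
Definition normal_field rho x : 'rV[R]_n :=
  (Num.sqrt (dot (gradient rho x) (gradient rho x)))^-1 *: gradient rho x.

Definition outward_unit_normal Omega p v : Prop :=
  exists U rho, local_defining Omega p U rho /\ v = normal_field rho p.

Definition strictly_star_shaped Omega : Prop :=
  Omega 0 /\ forall p v, boundary Omega p -> outward_unit_normal Omega p v ->
    0 < dot p v.

(* The matrix of the shape operator v |-> 'D_v nu (p) of the tangent space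
   in an orthonormal basis given by the rows of [B].  With the row-vector
   convention of ['J], ['D_v nu p = v *m 'J nu p].  As [nu] points outward,
   the sphere of radius r has shape operator r^-1. *)
Definition shape_mx rho p (B : 'M[R]_(n.-1, n)) : 'M[R]_n.-1 :=
  B *m 'J (normal_field rho) p *m B^T.

Definition tangent_orthonormal_basis rho p (B : 'M[R]_(n.-1, n)) : Prop :=
  B *m B^T = 1%:M /\ B *m (gradient rho p)^T = 0.

Definition principal_curvatures Omega p (kappa : 'rV[R]_n.-1) : Prop :=
  exists U rho B, [/\ local_defining Omega p U rho,
    tangent_orthonormal_basis rho p B &
    eigenvalue_vector (shape_mx rho p B) kappa].

Definition strictly_convex_boundary (j : nat) Omega : Prop :=
  forall p, boundary Omega p ->
    exists2 kappa, principal_curvatures Omega p kappa & Gamma j kappa.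

Definition minkowski_gauge Omega x : R :=
  inf [set s | 0 < s /\ ( *:%R s @` Omega) x].

End Domains.

(* Main.v *)
(* With g = grad mu, the Hessian of Psi is
   exp (T (mu - 1)) (D^2 mu + T g^T g), and homogeneity of the gauge mu moves it
   to a boundary point.  There sigma_{j+1} of the rank-one perturbation
   D^2 mu + c g^T g is affine in c, with slope |g|^2 sigma_j of the tangential
   block of D^2 mu; that block is a positive multiple of the shape operator, so
   the slope is positive for j < k and a large c wins, uniformly because the
   boundary is compact.  Smoothness of mu away from 0 comes from bootstrapping
   the implicit-function formula
   grad mu (x) = grad rho (q) / (q . grad rho (q)), q = x / mu x,
   valid for every local defining function rho. *)
From HB Require Import structures.
From mathcomp Require Import perm complex spectral ring lra.
Require Import Defs.
Set Implicit Arguments.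
Unset Strict Implicit.
Unset Printing Implicit Defensive.
Local Open Scope classical_set_scope.
Local Open Scope ring_scope.

(** * Differentiable functions of several variables *)

(** The boundary hypothesis gives no sign for sigma_k of the curvatures, so D^2 mu alone need not
    lie in Gamma_k; the exponential is there to supply the missing direction g^T g, and T is its
    weight. Passing from the boundary to the unbounded set E costs nothing: homogeneity multiplies
    D^2 mu by 1 / mu x but leaves g^T g unchanged, so once 1 / mu x is factored out the weight is T
    mu x, which exceeds T because mu x > 1 outside. Hence T can be the boundary threshold itself.
    Star-shapedness is an infinitesimal condition on the boundary. That the open segment from 0 to a
    point of the closure stays in Omega is deduced from it by a supremum argument, and the same
    positivity of p . grad rho (p) is the nondegeneracy behind the implicit-function formula.
    Defining functions and tangent frames are given point by point, with no continuity in p. For the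
    compactness argument the slope in c is therefore rewritten as the value at c = 1 minus the value
    at c = 0, which involves mu alone and is continuous. *)

Section EpsilonDelta.
Context {R : realType}.

Lemma near_normP (V : normedModType R) (x : V) (P : V -> Prop) :
  (\forall y \near x, P y) <->
  exists2 d : R, 0 < d & forall y : V, `|y - x| < d -> P y.
Proof.
split=> [/nbhs_normP[d /= d0 dP]|[d d0 dP]].
  by exists d => // y yx; apply: dP; rewrite /= distrC.
by apply/nbhs_normP; exists d => // y /=; rewrite distrC => /dP.
Qed.

Lemma continuous_normP (V : normedModType R) (f : V -> R) (x : V) :
  {for x, continuous f} <->
  forall e : R, 0 < e -> exists2 d : R, 0 < d & forall y : V, `|y - x| < d -> `|f y - f x| < e.
Proof.
split=> [fc e e0|fc].
  apply/near_normP.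
  by move/cvgrPdist_lt: fc => /(_ _ e0); apply: filterS => y; rewrite distrC.
apply/cvgrPdist_lt => e /fc /near_normP.
by apply: filterS => y; rewrite distrC.
Qed.

Lemma sum_continuous_at (T : topologicalType) (I : Type) (r : seq I)
    (F : I -> T -> R) x : (forall k, {for x, continuous (F k)}) ->
  {for x, continuous (fun y => \sum_(k <- r) F k y)}.
Proof.
move=> Fc; rewrite /prop_for /continuous_at.
apply: (cvg_big (op := +%R)) => [|k _]; last exact: Fc.
exact: add_continuous.
Qed.

Lemma dist_half_le (u v w e : R) :
  `|u - v| < e / 2 -> `|u - w| < e / 2 -> `|v - w| <= e.
Proof.
rewrite !ltr_norml => /andP[? ?] /andP[? ?].
by rewrite ler_norml; apply/andP; split; lra.
Qed.

End EpsilonDelta.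

Section Differentiability.
Context {R : realType} {n : nat}.
Implicit Types (f : 'rV[R]_n -> R) (x y h v a : 'rV[R]_n).

Lemma ler_norm_entry v i : `|v 0 i| <= `|v|.
Proof.
rewrite [leRHS]/Num.Def.normr/= mx_normrE.
exact: (le_bigmax _ (fun p => `|v p.1 p.2|) (0, i)).
Qed.

Lemma normr_dot_le v a : `|dot v a| <= n%:R * `|v| * `|a|.
Proof.
apply: le_trans (ler_norm_sum _ _ _) _.
rewrite -mulrA -[n in n%:R]card_ord mulr_natl -sumr_const; apply: ler_sum => i _.
by rewrite normrM ler_pM // ler_norm_entry.
Qed.

Lemma dotDl u v a : dot (u + v) a = dot u a + dot v a.
Proof. by rewrite -big_split; apply: eq_bigr => i _; rewrite mxE mulrDl. Qed.

Lemma dotZl c v a : dot (c *: v) a = c * dot v a.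
Proof. by rewrite mulr_sumr; apply: eq_bigr => i _; rewrite mxE mulrA. Qed.

Lemma dotNl v a : dot (- v) a = - dot v a.
Proof. by rewrite -scaleN1r dotZl mulN1r. Qed.

Lemma dotBl u v a : dot (u - v) a = dot u a - dot v a.
Proof. by rewrite dotDl dotNl. Qed.

Lemma dotC u v : dot u v = dot v u :> R.
Proof. by apply: eq_bigr => i _; rewrite mulrC. Qed.

Lemma dot_delta i a : dot (delta_mx 0 i) a = a 0 i.
Proof.
rewrite /dot (bigD1 i) //= big1 ?addr0 => [|j ji]; rewrite mxE ?eqxx ?mul1r //.
by rewrite (negPf ji) mul0r.
Qed.

(** The vector comes last and the values lie in [R^o], so that this functional can carry the linear
    structure required by uniqueness of the differential. *)
Definition dotr a v : R^o := dot v a.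

Lemma dotr_is_linear a : linear (dotr a).
Proof. by move=> c u v; rewrite /dotr dotDl dotZl. Qed.

HB.instance Definition _ a :=
  GRing.isLinear.Build R 'rV[R]_n R^o _ (dotr a) (dotr_is_linear a).

Lemma dotr_continuous a : continuous (dotr a).
Proof.
move=> x; apply: sum_continuous_at => i.
exact: (cvgM (@coord_continuous R 1 n 0 i x) (cvg_cst (a 0 i))).
Qed.

Lemma diff_gradient f x v : differentiable f x -> 'd f x v = dot v (gradient f x).
Proof.
move=> df; rewrite {1}(row_sum_delta v) linear_sum; apply: eq_bigr => i _.
by rewrite linearZ /= mxE /pderiv deriveE.
Qed.

Lemma differentiable_approx f x (e : R) : differentiable f x -> 0 < e ->
  exists2 d : R, 0 < d & forall y, `|y - x| < d ->
    `|f y - f x - dot (y - x) (gradient f x)| <= e * `|y - x|.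
Proof.
move=> df e0; have /eqaddoP/(_ e e0) := diff_locally df.
case/near_normP => d d0 dP; exists d => // y yx.
have := dP (y - x); rewrite subr0 => /(_ yx); rewrite /= !fctE /= subrK.
by rewrite diff_gradient // opprD addrA.
Qed.

(** Uniqueness of the differential lets a single epsilon-delta estimate yield both differentiability
    and the value of the gradient. The gauge is differentiated in this way. *)
Lemma approx_differentiable f x a :
  (forall e : R, 0 < e -> exists2 d : R, 0 < d & forall y, `|y - x| < d ->
    `|f y - f x - dot (y - x) a| <= e * `|y - x|) ->
  differentiable f x /\ gradient f x = a.
Proof.
move=> fa.
have fo : f \o shift x = cst (f x) + dotr a +o_ (0 : 'rV[R]_n) id.
  apply/eqaddoP => e /fa[d d0 dP].
  suff : \forall h \near (0 : 'rV[R]_n), `|f (h + x) - (f x + dot h a)| <= e * `|h|.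
    by [].
  apply/nbhs_norm0P; exists d => // h /= hd; have := dP (h + x).
  by rewrite addrK opprD addrA; exact.
have dE := diff_unique (@dotr_continuous a) fo.
have df : differentiable f x.
  by apply/diff_locallyP; rewrite dE; split => //; exact: dotr_continuous.
split=> //; apply/rowP => i; rewrite mxE /pderiv deriveE // dE.
exact: dot_delta.
Qed.

Lemma is_derive_line f x v (s : R) : derivable f (x + s *: v) v ->
  is_derive s 1 (fun s => f (x + s *: v)) ('D_v f (x + s *: v)).
Proof.
move=> df; have E : (fun h : R => h^-1 *:
      (((fun s => f (x + s *: v)) \o shift s) (h *: 1) - f (x + s *: v))) =
    (fun h : R => h^-1 *: ((f \o shift (x + s *: v)) (h *: v) - f (x + s *: v))).
  apply/funext => h /=; congr (_ *: (f _ - _)).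
  by rewrite [h%:A]mulr1 scalerDl addrCA.
by split; rewrite /derivable /derive ?E.
Qed.

(** The parameter [t] may have either sign, because the coordinate increments to which this is
    applied do. *)
Lemma line_MVT f x v (t : R) : (forall c : R, `|c| <= `|t| -> derivable f (x + c *: v) v) ->
  exists2 c : R, `|c| <= `|t| & f (x + t *: v) - f x = t * 'D_v f (x + c *: v).
Proof.
move=> df; pose g (s : R) : R := f (x + s *: v); pose dg (s : R) : R := 'D_v f (x + s *: v).
have gx : g 0 = f x by rewrite /g scale0r addr0.
have [t0|t0] := leP 0 t.
  have dP s : s \in `[0, t] -> is_derive s 1 g (dg s).
    rewrite in_itv /= => /andP[s0 st]; apply: is_derive_line; apply: df.
    by rewrite !ger0_norm // (le_trans s0).
  have gc : {within `[0, t], continuous g}.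
    by apply: derivable_within_continuous => s /dP [].
  have [c + E] := MVT_segment t0 (fun s H => dP s (subset_itv_oo_cc H)) gc.
  rewrite in_itv /= => /andP[c0 ct].
  by exists c; rewrite ?ger0_norm // -gx [RHS]mulrC -[t in RHS]subr0.
have dP s : s \in `[t, 0] -> is_derive s 1 g (dg s).
  rewrite in_itv /= => /andP[s0 st]; apply: is_derive_line; apply: df.
  by rewrite !ler0_norm ?lerN2 // ltW.
have gc : {within `[t, 0], continuous g}.
  by apply: derivable_within_continuous => s /dP [].
have [c + E] := MVT_segment (ltW t0) (fun s H => dP s (subset_itv_oo_cc H)) gc.
rewrite in_itv /= => /andP[c0 ct].
exists c; first by rewrite !ler0_norm ?lerN2 // ltW.
by rewrite -gx -opprB E sub0r mulrN opprK mulrC.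
Qed.

(** Move from [x] to [y] one coordinate at a time and apply the mean value theorem on each segment;
    near [x] the partial derivatives met there are close to those at [x]. *)
Lemma C1_differentiable f x :
  (\forall y \near x, forall i, derivable f y (delta_mx 0 i)) ->
  (forall i, {for x, continuous (pderiv i f)}) -> differentiable f x.
Proof.
move=> /near_normP[d0 d00 df] fc.
apply: (proj1 (@approx_differentiable _ _ (gradient f x) _)) => e e0.
(* Each of the [n] segments may contribute this much; [n.+1] keeps the divisor positive when [n] is
   0. *)
have e'0 : 0 < e / n.+1%:R by rewrite divr_gt0.
have [d1 d10 dfc] : exists2 d : R, 0 < d & forall y, `|y - x| < d ->
    forall i, `|pderiv i f y - pderiv i f x| <= e / n.+1%:R.
  apply/near_normP.
  suff H i : \forall y \near x, `|pderiv i f y - pderiv i f x| <= e / n.+1%:R.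
    exact: (@filter_forall _ _ _ _ _ H).
  apply/near_normP; have /continuous_normP/(_ _ e'0)[d d0' dP] := fc i.
  by exists d => // y /dP /ltW.
exists (Num.min d0 d1); first by rewrite lt_min d00.
move=> y; rewrite lt_min => /andP[y0 y1].
have [h hE] : exists h, h = y - x by exists (y - x).
rewrite -hE in y0 y1 *.
(* The corners of the path: [x + q k] already has the first [k] coordinates of [y]. *)
pose q (k : nat) : 'rV[R]_n := \row_i (if (i < k)%N then h 0 i else 0).
have q0 : q 0 = 0 by apply/rowP => i; rewrite !mxE.
have qn : q n = h by apply/rowP => i; rewrite !mxE ltn_ord.
have qS (i : 'I_n) : q i.+1 = q i + h 0 i *: delta_mx 0 i.
  apply/rowP => j; rewrite !mxE ltnS leq_eqVlt eqxx /=.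
  have [->|ji] := eqVneq j i; first by rewrite eqxx ltnn mulr1 add0r.
  by rewrite -val_eqE /= in ji; rewrite (negPf ji) mulr0 addr0.
have qle (i : 'I_n) c : `|c| <= `|h 0 i| -> `|x + q i + c *: delta_mx 0 i - x| <= `|h|.
  move=> ch; rewrite -[x + q i + _]addrA [x + _]addrC addrK.
  rewrite [leLHS]/Num.Def.normr/= mx_normrE.
  apply/bigmax_leP; split=> [//|[z j] _ /=]; rewrite ord1 {z} !mxE eqxx /=.
  have [->|ji] := eqVneq j i.
    by rewrite ltnn add0r mulr1 (le_trans ch) // ler_norm_entry.
  rewrite mulr0 addr0; case: ifP => _; first exact: ler_norm_entry.
  by rewrite normr0; exact: normr_ge0.
have -> : f y - f x = \sum_(i < n) (f (x + q i.+1) - f (x + q i)).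
  rewrite -(big_mkord xpredT (fun i => f (x + q i.+1) - f (x + q i))).
  rewrite telescope_sumr // q0 qn addr0 hE [x + _]addrC subrK //.
rewrite /dot -sumrB; apply: le_trans (ler_norm_sum _ _ _) _.
have step (i : 'I_n) : `|f (x + q i.+1) - f (x + q i) - h 0 i * gradient f x 0 i|
    <= e / n.+1%:R * `|h|.
  have [|c ch] := @line_MVT f (x + q i) (delta_mx 0 i) (h 0 i).
    by move=> c ch; apply: df; apply: le_lt_trans (qle _ _ ch) _.
  rewrite qS addrA => ->; rewrite mxE -mulrBr normrM mulrC ler_pM //.
    by apply: dfc; apply: le_lt_trans (qle _ _ ch) _.
  exact: ler_norm_entry.
apply: le_trans (ler_sum _ (fun i _ => step i)) _.
rewrite sumr_const card_ord -[leLHS]mulr_natr mulrAC; apply: ler_wpM2r => //.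
by rewrite -mulrA ler_piMr ?(ltW e0) // ler_pdivrMl // mulr1 ler_nat.
Qed.

(** The mean value theorem is used twice: in direction [i] for the difference of [f] along two
    parallel segments, then in direction [j] for [pderiv i f]. *)
Lemma second_difference f x i j (t : R) : 0 <= t ->
  (forall c c' : R, `|c| <= t -> `|c'| <= t ->
     derivable f (x + c *: delta_mx 0 i + c' *: delta_mx 0 j) (delta_mx 0 i) /\
     derivable (pderiv i f) (x + c *: delta_mx 0 i + c' *: delta_mx 0 j)
       (delta_mx 0 j)) ->
  exists c c' : R, [/\ `|c| <= t, `|c'| <= t &
    f (x + t *: delta_mx 0 i + t *: delta_mx 0 j) - f (x + t *: delta_mx 0 i)
      - f (x + t *: delta_mx 0 j) + f x =
    t ^+ 2 * pderiv j (pderiv i f) (x + c *: delta_mx 0 i + c' *: delta_mx 0 j)].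
Proof.
move=> t0 df; set u := delta_mx 0 i; set w := delta_mx 0 j.
have tt : `|t| <= t by rewrite ger0_norm.
pose g (s : R) : R := f (x + t *: w + s *: u) - f (x + s *: u).
pose dg (s : R) : R := pderiv i f (x + t *: w + s *: u) - pderiv i f (x + s *: u).
have dP s : s \in `[0, t] -> is_derive s 1 g (dg s).
  rewrite in_itv /= => /andP[s0 st].
  have ss : `|s| <= t by rewrite ger0_norm.
  apply: is_deriveB; apply: is_derive_line.
    by rewrite addrAC; have [] := df _ _ ss tt.
  by rewrite -[_ + s *: u]addr0 -(scale0r w); have [] := df s 0; rewrite ?normr0.
have gc : {within `[0, t], continuous g}.
  by apply: derivable_within_continuous => s /dP [].
have [c + E] := MVT_segment t0 (fun s H => dP s (subset_itv_oo_cc H)) gc.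
rewrite in_itv /= => /andP[c0 ct].
have ct' : `|c| <= t by rewrite ger0_norm.
have [|c' c't E'] := @line_MVT (pderiv i f) (x + c *: u) w t.
  by move=> s; rewrite (ger0_norm t0) => st; have [] := df c s.
exists c, c'; split=> //; first by rewrite (ger0_norm t0) in c't.
rewrite subr0 in E; rewrite expr2 -mulrA.
rewrite [pderiv j _ _]/pderiv -E' mulrC.
transitivity (g t - g 0); last by rewrite E /dg addrAC.
by rewrite /g scale0r !addr0 [x + t *: w + _]addrAC; ring.
Qed.

(** The second difference is symmetric in [i] and [j]. Evaluating it in both orders makes the two
    mixed derivatives agree at two points arbitrarily near [x], and continuity brings both to
    [x]. *)
Lemma pderivC f x i j :
  (\forall y \near x, [/\ derivable f y (delta_mx 0 i), derivable f y (delta_mx 0 j),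
     derivable (pderiv i f) y (delta_mx 0 j) &
     derivable (pderiv j f) y (delta_mx 0 i)]) ->
  {for x, continuous (pderiv j (pderiv i f))} ->
  {for x, continuous (pderiv i (pderiv j f))} ->
  pderiv j (pderiv i f) x = pderiv i (pderiv j f) x.
Proof.
move=> /near_normP[d0 d00 df] /continuous_normP c1 /continuous_normP c2.
apply/eqP; rewrite -subr_eq0 -normr_le0; apply/ler_addgt0Pr => e e0.
have [d1 d10 dP1] := c1 _ (divr_gt0 e0 (ltr0Sn _ 1)).
have [d2 d20 dP2] := c2 _ (divr_gt0 e0 (ltr0Sn _ 1)).
pose d := Num.min d0 (Num.min d1 d2).
have d_gt0 : 0 < d by rewrite !lt_min d00 d10.
have [t t0 near_x] : exists2 t : R, 0 < t & forall (k l : 'I_n) (c c' : R),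
    `|c| <= t -> `|c'| <= t ->
    [/\ `|x + c *: delta_mx 0 k + c' *: delta_mx 0 l - x| < d0,
       `|x + c *: delta_mx 0 k + c' *: delta_mx 0 l - x| < d1 &
       `|x + c *: delta_mx 0 k + c' *: delta_mx 0 l - x| < d2].
  (* Two coordinate steps of length at most [d / 3] stay strictly within distance [d]. *)
  exists (d / 3%:R) => [|k l c c' ct c't]; first by rewrite divr_gt0.
  apply/and3P; rewrite -!lt_min -/d.
  rewrite -[x + _ + _]addrA [x + _]addrC addrK.
  apply: le_lt_trans (ler_normD _ _) _.
  have nd (m : 'I_n) : `|delta_mx 0 m : 'rV[R]_n| <= 1.
    rewrite [leLHS]/Num.Def.normr/= mx_normrE.
    apply/bigmax_leP; split=> // [[z q] _ /=]; rewrite !mxE.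
    by case: (_ && _); rewrite ?normr1 ?normr0.
  rewrite !normrZ; apply: (@le_lt_trans _ _ (d / 3%:R + d / 3%:R)).
    by apply: lerD; rewrite -[leRHS]mulr1; apply: ler_pM.
  lra.
have Hij (c c' : R) : `|c| <= t -> `|c'| <= t ->
    derivable f (x + c *: delta_mx 0 i + c' *: delta_mx 0 j) (delta_mx 0 i) /\
    derivable (pderiv i f) (x + c *: delta_mx 0 i + c' *: delta_mx 0 j)
      (delta_mx 0 j).
  by move=> ct c't; have [/df[]] := near_x i j _ _ ct c't.
have Hji (c c' : R) : `|c| <= t -> `|c'| <= t ->
    derivable f (x + c *: delta_mx 0 j + c' *: delta_mx 0 i) (delta_mx 0 j) /\
    derivable (pderiv j f) (x + c *: delta_mx 0 j + c' *: delta_mx 0 i)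
      (delta_mx 0 i).
  by move=> ct c't; have [/df[]] := near_x j i _ _ ct c't.
have [a [a' [at1 at2 Ea]]] := second_difference (ltW t0) Hij.
have [b [b' [bt1 bt2 Eb]]] := second_difference (ltW t0) Hji.
have {Ea Eb} : t ^+ 2 * pderiv j (pderiv i f) (x + a *: delta_mx 0 i + a' *: delta_mx 0 j)
  = t ^+ 2 * pderiv i (pderiv j f) (x + b *: delta_mx 0 j + b' *: delta_mx 0 i).
  refine (etrans (Logic.eq_sym Ea) (etrans _ Eb)).
  rewrite [x + t *: delta_mx 0 j + _]addrAC; congr (_ + _).
  exact: addrAC.
move/(mulfI (lt0r_neq0 (exprn_gt0 2 t0))) => E.
have [_ /dP1 {}dP1 _] := near_x i j _ _ at1 at2.
have [_ _ /dP2 {}dP2] := near_x j i _ _ bt1 bt2.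
rewrite E in dP1; rewrite add0r.
exact: (dist_half_le dP1 dP2).
Qed.

End Differentiability.

(** * Calculus rules for partial derivatives *)

Section PartialDerivativeRules.
Context {R : realType} {n : nat}.
Implicit Types (f g : 'rV[R]_n -> R) (x : 'rV[R]_n) (i j : 'I_n).

Lemma differentiable_near_eq f g x : (\forall y \near x, f y = g y) ->
  differentiable f x -> differentiable g x /\ gradient g x = gradient f x.
Proof.
move=> fg df; apply: approx_differentiable => e /(differentiable_approx df)[d d0 dP].
have /near_normP[d' d'0 fgP] := fg.
exists (Num.min d d') => [|y]; first by rewrite lt_min d0.
rewrite lt_min => /andP[/dP yd /fgP <-].
by rewrite -(nbhs_singleton fg).
Qed.

Lemma pderiv_gradient f x i : pderiv i f x = gradient f x 0 i.
Proof. by rewrite mxE. Qed.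

Lemma pderiv_near_eq f g x i : (\forall y \near x, f y = g y) ->
  pderiv i f x = pderiv i g x.
Proof. exact: near_eq_derive. Qed.

Lemma pderivD f g x i : differentiable f x -> differentiable g x ->
  pderiv i (fun y => f y + g y) x = pderiv i f x + pderiv i g x.
Proof. by move=> df dg; apply: deriveD; exact: diff_derivable. Qed.

Lemma pderivM f g x i : differentiable f x -> differentiable g x ->
  pderiv i (fun y => f y * g y) x = f x * pderiv i g x + g x * pderiv i f x.
Proof. by move=> df dg; apply: deriveM; exact: diff_derivable. Qed.

Lemma pderivV f x i : differentiable f x -> f x != 0 ->
  pderiv i (fun y => (f y)^-1) x = - ((f x)^-1 * (f x)^-1) * pderiv i f x.
Proof.
move=> df fx; rewrite -expr2 exprVn.
by apply: deriveV => //; exact: diff_derivable.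
Qed.

Lemma expR_differentiable (t : R) : differentiable expR t /\ forall v, 'd expR t v = expR t * v.
Proof.
have [dE E] := is_derive_expR t.
have dd : differentiable (expR : R -> R) t by exact/derivable1_diffP.
split=> // v; rewrite (deriv1E dE) derive1E E; exact: mulrC.
Qed.

Lemma differentiable_expR f x : differentiable f x ->
  differentiable (fun y => expR (f y)) x.
Proof. by move=> df; apply: (differentiable_comp df); have [] := expR_differentiable (f x). Qed.

Lemma pderiv_expR f x i : differentiable f x ->
  pderiv i (fun y => expR (f y)) x = expR (f x) * pderiv i f x.
Proof.
move=> df; have [dE E] := expR_differentiable (f x).
rewrite /pderiv !deriveE //; last exact: differentiable_expR.
by rewrite (diff_comp df dE) /= E.
Qed.

Lemma pderiv_coord j i x :
  pderiv i (fun y => y 0 j) x = (i == j)%:R.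
Proof.
rewrite /pderiv deriveE; last exact: differentiable_coord.
have lin : linear (fun y : 'rV[R]_n => y 0 j : R^o) by move=> c u v; rewrite !mxE.
pose L : {linear 'rV[R]_n -> R^o} := HB.pack (fun y : 'rV[R]_n => y 0 j : R^o)
  (GRing.isLinear.Build R _ R^o _ _ lin).
rewrite (diff_lin (f := L)) /L /=; first by rewrite mxE eqxx eq_sym.
exact: coord_continuous.
Qed.

End PartialDerivativeRules.

(** * The classes C^m and their closure properties *)

Section FiniteSmoothness.
Context {R : realType}.

(** Full differentiability is demanded at each level, rather than existence of partial derivatives
    as in [smooth_on], so that the chain rule is available throughout inductions on [m]. *)
Fixpoint Cn n (m : nat) (U : set 'rV[R]_n) (f : 'rV[R]_n -> R) : Prop :=
  match m with
  | 0 => forall x, U x -> {for x, continuous f}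
  | m.+1 => (forall x, U x -> differentiable f x) /\
            forall i, Cn m U (pderiv i f)
  end.

Lemma CnW n m (U : set 'rV[R]_n) f : Cn m.+1 U f -> Cn m U f.
Proof.
elim: m f => [|m IH] f [df dfC]; first by move=> x Ux; exact/differentiable_continuous/df.
by split=> // i; exact/IH.
Qed.

Lemma Cn_eq n m (U : set 'rV[R]_n) f g : open U ->
  (forall x, U x -> f x = g x) -> Cn m U f -> Cn m U g.
Proof.
move=> oU; have near_eq (f1 g1 : 'rV[R]_n -> R) x : (forall x, U x -> f1 x = g1 x) ->
    U x -> \forall y \near x, f1 y = g1 y.
  move=> fg Ux; have : \forall y \near x, U y by exact: open_nbhs_nbhs.
  by apply: filterS => y /fg.
elim: m f g => [|m IH] f g fg.
  move=> fC x Ux; have := near_eq f g x fg Ux => fgx.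
  rewrite /prop_for /continuous_at -(fg _ Ux).
  exact: (cvg_trans (near_eq_cvg fgx) (fC x Ux)).
move=> [df dfC]; split=> [x Ux|i].
  by have [] := differentiable_near_eq (near_eq f g x fg Ux) (df x Ux).
apply: (IH (pderiv i f) _ _ (dfC i)) => x Ux.
exact: pderiv_near_eq (near_eq f g x fg Ux).
Qed.

Lemma Cn_sub n m (U V : set 'rV[R]_n) f : V `<=` U -> Cn m U f -> Cn m V f.
Proof.
move=> VU; elim: m f => [|m IH] f; first by move=> fC x /VU; exact: fC.
by move=> [df dfC]; split=> [x /VU|i]; [exact: df|exact: IH (dfC i)].
Qed.

(** This allows a different local defining function near each point. *)
Lemma Cn_local n m (W : set 'rV[R]_n) f : open W ->
  (forall x, W x -> exists V : set 'rV[R]_n, [/\ open V, V x & Cn m V f]) ->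
  Cn m W f.
Proof.
move=> oW; elim: m f => [|m IH] f fC.
  by move=> x /fC[V [_ Vx]]; apply.
split=> [x /fC[V [_ Vx [df _]]]|i]; first exact: df.
by apply: IH => x /fC[V [oV Vx [_ dC]]]; exists V; split=> //; exact: dC.
Qed.

Lemma Cn_cst n m (U : set 'rV[R]_n) (c : R) : open U -> Cn m U (fun=> c).
Proof.
move=> oU; elim: m c => [|m IH] c; first by move=> x _; exact: (@cst_continuous _ _ c x).
split=> [x _|i]; first exact: differentiable_cst.
by apply: (Cn_eq oU _ (IH 0)) => x _; rewrite /pderiv derive_cst.
Qed.

Lemma Cn_coord n m (U : set 'rV[R]_n) j : open U -> Cn m U (fun x => x 0 j).
Proof.
move=> oU; case: m => [|m]; first by move=> x _; exact: coord_continuous.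
split=> [x _|i]; first exact: differentiable_coord.
by apply: (Cn_eq oU _ (Cn_cst m (i == j)%:R oU)) => x _; rewrite pderiv_coord.
Qed.

Lemma CnD n m (U : set 'rV[R]_n) f g : open U ->
  Cn m U f -> Cn m U g -> Cn m U (fun x => f x + g x).
Proof.
move=> oU; elim: m f g => [|m IH] f g.
  by move=> fC gC x Ux; exact: (cvgD (fC x Ux) (gC x Ux)).
move=> [df fC] [dg gC]; split=> [x Ux|i]; first exact: differentiableD (df x Ux) (dg x Ux).
apply: (Cn_eq oU _ (IH _ _ (fC i) (gC i))) => x Ux.
by rewrite (pderivD _ (df x Ux) (dg x Ux)).
Qed.

Lemma CnM n m (U : set 'rV[R]_n) f g : open U ->
  Cn m U f -> Cn m U g -> Cn m U (fun x => f x * g x).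
Proof.
move=> oU; elim: m f g => [|m IH] f g.
  by move=> fC gC x Ux; exact: (cvgM (fC x Ux) (gC x Ux)).
move=> fC' gC'; have [[df fC] [dg gC]] := (fC', gC').
split=> [x Ux|i]; first exact: differentiableM (df x Ux) (dg x Ux).
apply: (Cn_eq oU _ (CnD oU (IH _ _ (CnW fC') (gC i)) (IH _ _ (CnW gC') (fC i)))).
by move=> x Ux; rewrite (pderivM _ (df x Ux) (dg x Ux)).
Qed.

Lemma Cn_sum n m (U : set 'rV[R]_n) (I : Type) (r : seq I) (F : I -> 'rV[R]_n -> R) :
  open U -> (forall k, Cn m U (F k)) -> Cn m U (fun x => \sum_(k <- r) F k x).
Proof.
move=> oU FC; elim: r => [|k r IHr].
  by apply: (Cn_eq oU _ (Cn_cst m 0 oU)) => x _; rewrite big_nil.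
by apply: (Cn_eq oU _ (CnD oU (FC k) IHr)) => x _; rewrite big_cons.
Qed.

Lemma CnV n m (U : set 'rV[R]_n) f : open U -> (forall x, U x -> f x != 0) ->
  Cn m U f -> Cn m U (fun x => (f x)^-1).
Proof.
move=> oU f0; elim: m => [|m IH].
  by move=> fC x Ux; exact: (cvgV (f0 x Ux) (fC x Ux)).
move=> fC'; have [df fC] := fC'.
split=> [x Ux|i]; first exact: differentiableV (df x Ux) (f0 x Ux).
have fVC := IH (CnW fC').
apply: (Cn_eq oU _ (CnM oU (CnM oU (Cn_cst m (-1) oU) (CnM oU fVC fVC)) (fC i))).
by move=> x Ux; rewrite (pderivV _ (df x Ux) (f0 x Ux)) mulN1r.
Qed.

Lemma Cn_expR n m (U : set 'rV[R]_n) f : open U ->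
  Cn m U f -> Cn m U (fun x => expR (f x)).
Proof.
move=> oU; elim: m => [|m IH].
  by move=> fC x Ux; apply: (continuous_comp (fC x Ux)); exact: continuous_expR.
move=> fC'; have [df fC] := fC'.
split=> [x Ux|i]; first exact: differentiable_expR (df x Ux).
apply: (Cn_eq oU _ (CnM oU (IH (CnW fC')) (fC i))).
by move=> x Ux; rewrite (pderiv_expR _ (df x Ux)).
Qed.

Lemma continuous_rV (V : normedModType R) p (Y : V -> 'rV[R]_p) x :
  (forall j, {for x, continuous (fun y => Y y 0 j)}) -> {for x, continuous Y}.
Proof.
move=> Yc; apply/cvgrPdist_le => e e0.
have H j : \forall y \near x, `|Y x 0 j - Y y 0 j| <= e.
  by have /cvgrPdist_le := Yc j; apply.
have : \forall y \near x, forall j, `|Y x 0 j - Y y 0 j| <= e.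
  exact: (@filter_forall _ _ _ _ _ H).
apply: filterS => y yj; rewrite [leLHS]/Num.Def.normr/= mx_normrE.
apply/bigmax_leP; split=> [|[k j] _]; first exact: ltW.
by rewrite ord1 !mxE; exact: yj.
Qed.

Lemma differentiable_rV n p (Y : 'rV[R]_n -> 'rV[R]_p) x :
  (forall j, differentiable (fun y => Y y 0 j) x) -> differentiable Y x.
Proof.
move=> dY.
have -> : Y = \sum_j (fun y => Y y 0 j *: delta_mx 0 j).
  by apply/funext => y; rewrite fct_sumE -row_sum_delta.
by apply: differentiable_sum => j; exact: differentiableZl.
Qed.

Lemma pderiv_comp n p (f : 'rV[R]_p -> R) (Y : 'rV[R]_n -> 'rV[R]_p) x :
  differentiable f (Y x) -> (forall j, differentiable (fun y => Y y 0 j) x) ->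
  differentiable (fun y => f (Y y)) x /\
  forall i, pderiv i (fun y => f (Y y)) x =
    \sum_j pderiv j f (Y x) * pderiv i (fun y => Y y 0 j) x.
Proof.
move=> df dY; have dYx := differentiable_rV dY.
have dfY := differentiable_comp dYx df; split=> // i.
rewrite /pderiv deriveE // (diff_comp dYx df) /= diff_gradient //.
apply: eq_bigr => j _; rewrite [gradient _ _ _ _]mxE mulrC; congr (_ * _).
by rewrite -deriveE // derive_mx ?mxE //; exact: diff_derivable.
Qed.

(** By the chain rule a partial derivative of the composite is a sum of products of [pderiv j f]
    composed with [Y], covered by the induction hypothesis for a new outer function, and derivatives
    of the entries of [Y]. *)
Lemma Cn_comp n p m (U : set 'rV[R]_n) (V : set 'rV[R]_p) f (Y : 'rV[R]_n -> 'rV[R]_p) :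
  open U -> (forall x, U x -> V (Y x)) -> (forall j, Cn m U (fun x => Y x 0 j)) ->
  Cn m V f -> Cn m U (fun x => f (Y x)).
Proof.
move=> oU UV; elim: m f => [|m IH] f YC.
  move=> fC x Ux; apply: (@continuous_comp _ _ _ Y f); last exact/fC/UV.
  by apply: continuous_rV => j; exact: YC.
move=> [df fC]; have dY x j : U x -> differentiable (fun y => Y y 0 j) x.
  by move=> Ux; have [dYj _] := YC j; exact: dYj.
have cE x Ux := pderiv_comp (df _ (UV x Ux)) (dY x ^~ Ux).
split=> [x Ux|i]; first by have [] := cE x Ux.
have YC' j : Cn m U (fun x => Y x 0 j) by exact/CnW/YC.
have C := Cn_sum (index_enum 'I_p) oU
  (fun j => CnM oU (IH _ YC' (fC j)) ((YC j).2 i)).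
apply: (Cn_eq oU _ C) => x Ux.
by have [_ ->] := cE x Ux.
Qed.

Lemma smooth_on_pderiv n (U : set 'rV[R]_n) f i :
  smooth_on U f -> smooth_on U (pderiv i f).
Proof.
by move=> fC s x Ux; have := fC (rcons s i) x Ux; rewrite /pderivs foldr_rcons.
Qed.

Lemma smooth_onP n (U : set 'rV[R]_n) f : open U ->
  smooth_on U f <-> forall m, Cn m U f.
Proof.
move=> oU; split=> [fC m|fC].
  elim: m f fC => [|m IH] f fC; first by move=> x Ux; have [] := fC [::] x Ux.
  split=> [x Ux|i]; last exact/IH/smooth_on_pderiv.
  apply: C1_differentiable => [|i]; last by have [] := fC [:: i] x Ux.
  have : \forall y \near x, U y by exact: open_nbhs_nbhs.
  by apply: filterS => y Uy i; have [_] := fC [::] y Uy; apply.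
(* The list is peeled from its right end because [pderivs] applies its last entry first. *)
move=> s; elim/last_ind: s f fC => [|s i IH] f fC x Ux.
  split=> [|i]; first by have := fC 0%N; apply.
  by have [df _] := fC 1%N; exact/diff_derivable/df.
by rewrite /pderivs foldr_rcons; apply: IH => // m; have [_] := fC m.+1; apply.
Qed.

End FiniteSmoothness.

(** * Elementary symmetric functions of the eigenvalues *)

Section ElementarySymmetricOfMatrix.
Context {R : realType}.

(* Unlike in [char_poly], the coefficient of ['X^j] is sigma_j itself: no sign
   and no index reversal. *)
Definition epoly m (A : 'M[R]_m) : {poly R} :=
  \det (1%:M + 'X *: map_mx polyC A).

Definition mxesym m j (A : 'M[R]_m) : R := (epoly A)`_j.

Lemma horner_epoly m (A : 'M[R]_m) x : (epoly A).[x] = \det (1%:M + x *: A).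
Proof.
rewrite /epoly -[LHS]/(horner_eval x _) -det_map_mx; congr (\det _).
apply/matrixP => i j; rewrite !mxE /= /horner_eval.
by rewrite hornerD hornerM hornerX hornerC hornerMn hornerC.
Qed.

(** A nonzero difference would vanish at 1, 2, ..., which is too many roots. The point 0 is left out
    so that [epoly_eigen] may divide by [x]. *)
Lemma eq_poly_nonzero (p q : {poly R}) : (forall x, x != 0 -> p.[x] = q.[x]) -> p = q.
Proof.
move=> pq; apply/eqP; rewrite -subr_eq0; apply/negPn/negP => nz.
pose s := [seq (i.+1)%:R : R | i <- iota 0 (size (p - q))].
have /max_poly_roots := nz => /(_ s).
have -> : all (root (p - q)) s.
  by apply/allP => _ /mapP[i _ ->]; rewrite rootE !hornerE pq ?pnatr_eq0 // subrr.
have -> : uniq s.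
  rewrite map_inj_uniq ?iota_uniq // => i j /eqP; rewrite eqr_nat => /eqP[].
  done.
by rewrite size_map size_iota ltnn => /(_ isT isT).
Qed.

(** [epoly] is the reciprocal characteristic polynomial: det (1 + x A) is (- x)^m times the
    characteristic polynomial at - 1 / x. *)
Lemma epoly_eigen m (A : 'M[R]_m) l : eigenvalue_vector A l ->
  epoly A = \prod_(i < m) (1 + (l 0 i) *: 'X).
Proof.
move=> ev; apply: eq_poly_nonzero => x x0; rewrite horner_epoly horner_prod.
have -> : 1%:M + x *: A = (- x) *: ((- x^-1)%:M - A).
  by rewrite scalerBr scale_scalar_mx mulrNN mulfV // scaleNr opprK.
rewrite detZ -[m in _ ^+ m]card_ord -prodr_const.
have -> : \det ((- x^-1)%:M - A) = (char_poly A).[- x^-1].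
  rewrite /char_poly -[RHS]/(horner_eval _ _) -det_map_mx; congr (\det _).
  apply/matrixP => i j; rewrite !mxE /= /horner_eval.
  by rewrite hornerD hornerN hornerC hornerMn hornerX.
rewrite ev horner_prod -big_split; apply: eq_bigr => i _ /=.
by rewrite !hornerE; field.
Qed.

Lemma mxesym_eigen m (A : 'M[R]_m) l j : eigenvalue_vector A l ->
  mxesym j A = esym j l.
Proof.
move=> /epoly_eigen eA; rewrite /mxesym eA /esym.
under eq_bigr do rewrite addrC.
rewrite bigA_distr coef_sum [RHS]big_mkcond /=.
apply: eq_bigr => J _; rewrite big_mkcond.
have -> : \prod_(i < m) (if i \in J then l 0 i *: 'X else 1)
   = (\prod_(i in J) l 0 i) *: 'X^#|J| :> {poly R}.
  rewrite -big_mkcond /= scaler_prod; congr (_ *: _).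
  by rewrite prodr_const.
rewrite coefZ coefXn eq_sym; case: eqP => _; rewrite ?mulr1 ?mulr0 //.
Qed.

Lemma epoly_conj m (Q A : 'M[R]_m) : Q *m Q^T = 1%:M ->
  epoly (Q *m A *m Q^T) = epoly A.
Proof.
move=> QQ; apply: eq_poly_nonzero => x _; rewrite !horner_epoly.
have -> : 1%:M + x *: (Q *m A *m Q^T) = Q *m (1%:M + x *: A) *m Q^T.
  by rewrite mulmxDr mulmxDl mulmx1 QQ -scalemxAr -scalemxAl.
rewrite !det_mulmx mulrAC -det_mulmx QQ det1 mul1r //.
Qed.

(** Scaling the matrix amounts to substituting [c *: 'X] for ['X] in [epoly A]. *)
Lemma mxesymZ m (A : 'M[R]_m) c j : mxesym j (c *: A) = c ^+ j * mxesym j A.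
Proof.
suff /(congr1 (fun p : {poly R} => p`_j)) : epoly (c *: A) = epoly A \Po (c *: 'X).
  rewrite /mxesym => ->.
  rewrite comp_polyE coef_sum.
  under eq_bigr do rewrite exprZn coefZ coefZ coefXn.
  have [js|js] := ltnP j (size (epoly A)).
    rewrite (bigD1 (Ordinal js)) //= eqxx mulr1 mulrC big1 ?addr0 // => i ij.
    by case: eqP => [e|_]; rewrite ?mulr0 //; case/eqP: ij; apply/val_inj.
  rewrite [(epoly A)`_j]nth_default // mulr0 big1 // => i _.
  by case: eqP => [e|_]; rewrite ?mulr0 //; move: (ltn_ord i); rewrite -e ltnNge js.
apply: eq_poly_nonzero => x _; rewrite horner_comp !horner_epoly !hornerE.
by rewrite scalerA mulrC.
Qed.

(** The determinant is linear in its row 0, which changes by [c * x] times the first unit vector;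
    with that unit vector as row 0 it reduces to the complementary minor. *)
Lemma epoly_corner m (A : 'M[R]_(1 + m)) c :
  epoly (A + c *: delta_mx 0 0) = epoly A + (c *: 'X) * epoly (drsubmx A).
Proof.
apply: eq_poly_nonzero => x _; rewrite hornerD hornerM !horner_epoly !hornerE.
pose D : 'M[R]_(1 + m) := block_mx 1%:M 0 (x *: dlsubmx A) (1%:M + x *: drsubmx A).
have -> : \det (1%:M + x *: drsubmx A) = \det D.
  by rewrite det_lblock det1 mul1r.
rewrite -[\det (_ + _ *: A)]mul1r; apply: (@determinant_multilinear _ (1 + m)%N _ _ D 0).
- apply/rowP => j; rewrite !mxE.
  case: (splitP j) => j' /= e.
    rewrite !ord1 in e *; have -> : j = 0 by apply/val_inj.
    rewrite !eqxx.
    case: splitP => // k _; rewrite !ord1 mxE; case: splitP => // k2 _; rewrite ord1 !mxE /=.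
    by ring.
  have -> : (j == 0 :> 'I_(1+m)) = false by apply/negbTE/eqP => /(congr1 val); rewrite /= e.
  case: splitP => // k _; rewrite mxE.
  case: splitP => k2 e2; first by move: e2; rewrite e ord1.
  rewrite mxE /=; ring.
- apply/matrixP => i j; rewrite !mxE /=; ring.
- apply/matrixP => i j; rewrite [LHS]mxE [RHS]mxE.
  have -> : lift 0 i = rshift 1 i :> 'I_(1 + m) by apply/val_inj.
  rewrite /D col_mxEd mxE; case: splitP => l e.
    have -> : j = lshift m l by apply/val_inj.
    by rewrite !mxE eq_rlshift mulr0 addr0 add0r.
  have -> : j = rshift 1 l by apply/val_inj.
  by rewrite !mxE eq_rshift mulr0 addr0.
Qed.

Lemma mxesym0 m (A : 'M[R]_m) : mxesym 0 A = 1.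
Proof. by rewrite /mxesym -horner_coef0 horner_epoly scale0r addr0 det1. Qed.

Lemma dotE m (u v : 'rV[R]_m) : u *m v^T = (dot u v)%:M.
Proof. by apply/matrixP=> i j; rewrite !ord1 !mxE; apply: eq_bigr => k _; rewrite mxE. Qed.

Lemma dot_ge0 m (u : 'rV[R]_m) : 0 <= dot u u.
Proof. by apply: sumr_ge0 => i _; rewrite -expr2 sqr_ge0. Qed.

Lemma dot_gt0 m (u : 'rV[R]_m) : u != 0 -> 0 < dot u u.
Proof.
move=> u0; rewrite lt0r dot_ge0 andbT; apply: contra_neq u0 => /eqP.
rewrite psumr_eq0 => [|i _]; last by rewrite -expr2 sqr_ge0.
by move=> /allP u0; apply/rowP => i; move: (u0 i (mem_index_enum _));
  rewrite -expr2 sqrf_eq0 mxE => /eqP.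
Qed.

(** In the orthonormal frame formed by the unit vector along [g] and the rows of [B], the
    perturbation sits in the corner entry, so [epoly_corner] applies; the factor ['X] there causes
    the drop from [j.+1] to [j]. *)
Lemma mxesym_rank1 m j (A : 'M[R]_m.+1) (g : 'rV[R]_m.+1) (B : 'M[R]_(m, m.+1)) c :
  g != 0 -> B *m B^T = 1%:M -> B *m g^T = 0 ->
  mxesym j.+1 (A + c *: (g^T *m g)) =
    mxesym j.+1 A + c * dot g g * mxesym j (B *m A *m B^T).
Proof.
move=> /dot_gt0 gg BB Bg; set s := Num.sqrt (dot g g).
have s0 : s != 0 by rewrite sqrtr_eq0 -ltNge.
have ss : dot g g = s ^+ 2 by rewrite sqr_sqrtr // ltW.
pose nu := s^-1 *: g.
pose Q : 'M[R]_(1 + m) := col_mx nu B.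
have gB : g *m B^T = 0 by rewrite -[g]trmxK -trmx_mul Bg trmx0.
have QQ : Q *m Q^T = 1%:M.
  rewrite tr_col_mx mul_col_row BB /nu !linearZ /= -!scalemxAl gB Bg.
  rewrite !scaler0 dotE ss !scale_scalar_mx.
  by rewrite [X in X%:M](_ : _ = 1) -?scalar_mx_block //; field.
have gQ : g *m Q^T = row_mx (s%:M) 0.
  rewrite tr_col_mx mul_mx_row gB /nu !linearZ /= dotE ss.
  by rewrite scale_scalar_mx [X in X%:M](_ : _ = s) //; field.
have QggQ : Q *m (g^T *m g) *m Q^T = (s ^+ 2) *: delta_mx 0 0.
  rewrite mulmxA -mulmxA gQ -[Q *m _]trmxK trmx_mul trmxK gQ tr_row_mx.
  rewrite mul_col_row !trmx0 !mul0mx mulmx0 tr_scalar_mx -scalar_mxM -expr2.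
  have -> : delta_mx 0 0 = block_mx 1%:M 0 0 0 :> 'M[R]_(1 + m).
    rewrite -[LHS](@submxK _ 1 m 1 m).
    by congr block_mx; apply/matrixP=> a b; rewrite ?ord1 !mxE ?eqxx.
  by rewrite [RHS](@scale_block_mx _ 1 m 1 m) scale_scalar_mx mulr1 !scaler0.
rewrite /mxesym -(epoly_conj (A + _) QQ) mulmxDr mulmxDl.
rewrite -scalemxAr -scalemxAl QggQ scalerA epoly_corner coefD epoly_conj //.
congr (_ + _); rewrite -scalerAl coefZ coefXM /= -ss; congr (_ * _ `_ _).
congr epoly; transitivity (drsubmx (col_mx nu B *m A *m row_mx nu^T B^T)).
  by rewrite -tr_col_mx.
by rewrite mul_col_mx mul_col_row block_mxKdr.
Qed.

Lemma mxesym_rank1_pred n j (A : 'M[R]_n) (g : 'rV[R]_n) (B : 'M[R]_(n.-1, n)) c :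
  (0 < n)%N -> g != 0 -> B *m B^T = 1%:M -> B *m g^T = 0 ->
  mxesym j.+1 (A + c *: (g^T *m g)) =
    mxesym j.+1 A + c * dot g g * mxesym j (B *m A *m B^T).
Proof. by case: n A g B => // n A g B _; exact: mxesym_rank1. Qed.

Lemma mxesym_continuous (T : topologicalType) m j (M : T -> 'M[R]_m) x :
  (forall a b, {for x, continuous (fun y => M y a b)}) ->
  {for x, continuous (fun y => mxesym j (M y))}.
Proof.
move=> Mc.
(* Coefficientwise continuity is stable under sums and products, so it passes through the Leibniz
   formula for the determinant. *)
pose P (F : T -> {poly R}) := forall i, {for x, continuous (fun y => (F y)`_i)}.
have Pcst p : P (fun=> p) by move=> i; exact: cvg_cst.
have Psum (I : finType) (F : I -> T -> {poly R}) :
    (forall k, P (F k)) -> P (fun y => \sum_k F k y).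
  move=> PF i; rewrite [X in {for x, continuous X}](_ : _ =
    fun y => \sum_k (F k y)`_i); last by apply/funext => y; rewrite coef_sum.
  by apply: sum_continuous_at => k; exact: PF.
have PM F G : P F -> P G -> P (fun y => F y * G y).
  move=> PF PG i; rewrite [X in {for x, continuous X}](_ : _ =
    fun y => \sum_(k < i.+1) (F y)`_k * (G y)`_(i - k)).
    by apply: sum_continuous_at => k; apply: cvgM; [exact: PF|exact: PG].
  by apply/funext => y; rewrite coefM.
have Pprod (I : Type) (r : seq I) (F : I -> T -> {poly R}) :
    (forall k, P (F k)) -> P (fun y => \prod_(k <- r) F k y).
  move=> PF; elim: r => [|k r IHr].
    by rewrite [X in P X](_ : _ = fun=> 1) //; apply/funext => y; rewrite big_nil.
  rewrite [X in P X](_ : _ = fun y => F k y * \prod_(l <- r) F l y).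
    by apply: PM.
  by apply/funext => y; rewrite big_cons.
suff : P (fun y => epoly (M y)) by apply.
apply: Psum => s; apply: PM => //; apply: Pprod => a i.
rewrite [X in {for x, continuous X}](_ : _ = fun y =>
    ((1%:M : 'M[{poly R}]_m) a (fun_of_perm s a))`_i +
      ('X : {poly R})`_i * M y a (fun_of_perm s a)).
  by apply: cvgD; [exact: cvg_cst|apply: cvgM; [exact: cvg_cst|exact: Mc]].
apply/funext => y; rewrite !mxE coefD; congr (_ + _).
by rewrite coefMC.
Qed.

(** Over the complex numbers [A] is Hermitian, hence unitarily diagonalizable with real diagonal.
    The factorization of the characteristic polynomial descends because the embedding of [R] is
    injective. *)
Lemma symmetric_eigenvalue_vector m (A : 'M[R]_m) : A^T = A ->
  exists l, eigenvalue_vector A l.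
Proof.
move=> As; pose f : {rmorphism R -> R[i]} := real_complex R.
pose C := map_mx f A.
have Ch : C \is hermsymmx.
  apply: realsym_hermsym.
    apply/is_hermitianmxP; rewrite expr0 scale1r.
    by apply/matrixP => a b; rewrite !mxE -{1}As mxE.
  by apply/mxOverP => i j; rewrite mxE; apply/complex_realP; exists (A i j).
have dr := hermitian_spectral_diag_real Ch.
have /orthomx_spectralP CE := hermitian_normalmx Ch.
set P := spectralmx C in CE; set d := spectral_diag C in dr CE.
have Pu : P \in unitmx := spectral_unit C.
exists (map_mx (@complex.Re R) d).
apply: (map_poly_inj f); rewrite map_char_poly -/C.
have -> : char_poly C = char_poly (diag_mx d).
  rewrite CE /char_poly.
  have -> : char_poly_mx (invmx P *m diag_mx d *m P) =
      map_mx polyC (invmx P) *m char_poly_mx (diag_mx d) *m map_mx polyC P.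
    rewrite /char_poly_mx mulmxBr mulmxBl !map_mxM /=; congr (_ - _).
    by rewrite -mulmxA -scalar_mxC mulmxA -map_mxM mulVmx // map_mx1 mul1mx.
  rewrite !det_mulmx mulrAC -det_mulmx -map_mxM mulVmx // map_mx1 det1.
  by rewrite mul1r.
rewrite char_poly_trig ?diag_mx_is_trig // rmorph_prod; apply: eq_bigr => i _.
rewrite rmorphB /= map_polyX map_polyC /= !mxE eqxx mulr1n.
by rewrite [f _]RRe_real //; exact: (mxOverP dr).
Qed.

End ElementarySymmetricOfMatrix.

(** * The gauge of a star-shaped domain *)

Lemma ray_sign (R : realType) (r c t : R) :
  `|r - (t - 1) * c| <= c / 2 * `|t - 1| -> 0 < c ->
  (t < 1 -> r < 0) /\ (1 < t -> 0 < r).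
Proof.
move=> h c0; split=> t1; move: h; rewrite ler_norml => /andP[].
  by rewrite ltr0_norm ?subr_lt0 //; nra.
by rewrite gtr0_norm ?subr_gt0 //; nra.
Qed.

(** Scalar core of the implicit-function argument. There [a] is the increment of the gauge, [h] the
    length of the displacement, [D] its product with the gradient of [rho], and [c] the radial
    derivative of [rho]. The unknown [a] also occurs in the error term and has to be absorbed. *)
Lemma implicit_step_eta (R : realType) (K Q c e : R) :
  0 <= K -> 0 <= Q -> 0 < c -> 0 < e ->
  exists2 eta : R, 0 < eta & forall a h D : R, 0 <= h ->
    `|D - a * c| <= eta * (h + `|a| * Q) -> `|D| <= K * h ->
    `|a - c^-1 * D| <= e * h.
Proof.
move=> K0 Q0 c0 e0.
(* A Lipschitz constant for [a]: with [eta * Q <= c / 2], half of [|a| * c] absorbs the error term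
   and leaves [|a| <= L * h]. *)
pose L := 2 * (K + 1) / c; have L0 : 0 <= L.
  by rewrite divr_ge0 ?(ltW c0) // mulr_ge0 // addr_ge0.
have LQ : 0 < 1 + L * Q by rewrite ltr_pwDl // mulr_ge0.
(* The first two bounds give the Lipschitz estimate; the third then makes the remaining error at
   most [e * c * h]. *)
pose eta := Num.min 1 (Num.min (c / 2 / (Q + 1)) (e * c / (1 + L * Q))).
have Q1 : 0 < Q + 1 by rewrite ltr_wpDl.
have eta0 : 0 < eta by rewrite !lt_min ltr01 !divr_gt0 // mulr_gt0.
exists eta => // a h D h0 h1 h2.
have [e1 e2 e3] : [/\ eta <= 1, eta * Q <= c / 2 & eta * (1 + L * Q) <= e * c].
  have /and3P[a1 a2 a3] : [&& eta <= 1, eta <= c / 2 / (Q + 1)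
      & eta <= e * c / (1 + L * Q)] by rewrite -!le_min.
  split=> //; last by rewrite -ler_pdivlMr.
  apply: le_trans (_ : eta * (Q + 1) <= _); last by rewrite -ler_pdivlMr.
  by rewrite ler_wpM2l ?(ltW eta0) // lerDl.
have ac : `|a| * c <= `|D| + `|D - a * c|.
  rewrite -{1}(gtr0_norm c0) -normrM -{1}[a * c](subKr D).
  exact: ler_normB.
have a0 := normr_ge0 a.
have aL : `|a| <= L * h.
  rewrite /L mulrAC ler_pdivlMr //.
  have t1 : eta * h <= h by rewrite ler_piMl.
  have t2 : `|a| * (eta * Q) <= `|a| * (c / 2) by rewrite ler_wpM2l.
  move: (`|D - _|) h1 ac h2 => d h1 ac h2; rewrite mulrDr mulrCA in h1.
  clear -t1 t2 h1 ac h2; lra.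
have -> : a - c^-1 * D = - (c^-1 * (D - a * c)).
  by rewrite mulrBr opprB mulrCA mulVf ?gt_eqF // mulr1.
rewrite normrN normrM gtr0_norm ?invr_gt0 // ler_pdivrMl //.
apply: le_trans h1 _; apply: le_trans (_ : eta * (1 + L * Q) * h <= _).
  rewrite -mulrA ler_wpM2l ?(ltW eta0) // mulrDl mul1r lerD2l mulrAC.
  by rewrite ler_wpM2r.
by rewrite mulrA [c * e]mulrC ler_wpM2r.
Qed.

Lemma sum_delta_sub (R : realType) (n : nat) (h p : 'I_n -> R) m i :
  \sum_k h k * ((i == k)%:R - p k * m) = h i - (\sum_k h k * p k) * m.
Proof.
under eq_bigr do rewrite mulrBr mulrA.
rewrite sumrB -mulr_suml (bigD1 i) //= eqxx mulr1 big1 ?addr0 // => k ki.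
by rewrite eq_sym (negPf ki) mulr0.
Qed.

Lemma hessian_entry (R : realType) (h b mi c d mj a : R) :
  h - b * mi = c * d + mj * a -> h = c * d + a * mj + mi * b.
Proof. by move=> /eqP; rewrite subr_eq => /eqP ->; ring. Qed.

(** A correction with a factor [g] on either side vanishes on vectors orthogonal to [g]. It serves
    twice: from the normal field to the Hessian of [rho], and from there to that of [mu]. *)
Lemma tangential_congruence (R : realType) m n (B : 'M[R]_(m, n)) (H M : 'M[R]_n)
    (c : R) (a b g : 'rV[R]_n) :
  B *m g^T = 0 -> H = c *: M + a^T *m g + g^T *m b ->
  B *m H *m B^T = c *: (B *m M *m B^T).
Proof.
move=> Bg ->; have gB : g *m B^T = 0 by rewrite -[g]trmxK -trmx_mul Bg trmx0.
rewrite !mulmxDr !mulmxDl -scalemxAr -scalemxAl.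
rewrite -[B *m (a^T *m g) *m _]mulmxA -[(a^T *m g) *m _]mulmxA gB !mulmx0 addr0.
by rewrite [B *m (g^T *m b)]mulmxA Bg !mul0mx addr0.
Qed.

Lemma scale_back (R : realType) (V : lmodType R) (s c : R) (X Y Z : V) :
  s * c != 0 -> X = s *: Y -> Y = c *: Z -> Z = (s * c)^-1 *: X.
Proof. by move=> sc -> ->; rewrite [s *: _]scalerA scalerA mulVf // scale1r. Qed.

Lemma hessian_Psi_entry (R : realType) (e m T h a b : R) : m != 0 ->
  e * (m^-1 * h) + b * (e * (T * a)) = e / m * (h + T * m * (a * b)).
Proof. by move=> m0; field. Qed.

Section StarShapedDomain.
Context {R : realType} {n : nat} (Omega : set 'rV[R]_n).
Context (dom : smooth_bounded_domain Omega) (star : strictly_star_shaped Omega).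
Implicit Types (x y p q : 'rV[R]_n) (rho : 'rV[R]_n -> R) (U : set 'rV[R]_n).

Let mu := minkowski_gauge Omega.

Lemma Omega_open : open Omega. Proof. by case: dom. Qed.

Lemma Omega0 : Omega 0. Proof. by case: star. Qed.

Lemma open_normP (A : set 'rV[R]_n) x : open A -> A x ->
  exists2 d : R, 0 < d & forall y, `|y - x| < d -> A y.
Proof. by move=> oA Ax; apply/near_normP; exact: open_nbhs_nbhs. Qed.

Lemma closureP (A : set 'rV[R]_n) x : closure A x <->
  forall d : R, 0 < d -> exists2 y, A y & `|y - x| < d.
Proof.
split=> [cA d d0|cA B /near_normP[d d0 dB]].
  have H : \forall y \near x, `|y - x| < d by apply/near_normP; exists d.
  by have [y [Ay xy]] := cA _ H; exists y.
by have [y Ay /dB By] := cA d d0; exists y.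
Qed.

Lemma boundaryP p : boundary Omega p <-> closure Omega p /\ ~ Omega p.
Proof. by have /interior_id OE := Omega_open; rewrite /boundary OE. Qed.

Lemma local_defining_at p q U rho : local_defining Omega p U rho -> U q ->
  local_defining Omega q U rho.
Proof. by case. Qed.

Lemma local_defining_differentiable p U rho x :
  local_defining Omega p U rho -> U x -> differentiable rho x.
Proof.
by move=> [oU _ /(smooth_onP _ oU)/(_ 1%N)[d _] _ _]; exact: d.
Qed.

Lemma local_defining0 p U rho : local_defining Omega p U rho ->
  boundary Omega p -> rho p = 0.
Proof.
move=> ld /boundaryP[cp np]; have [oU Up sr _ OE] := ld.
apply/le_anti/andP; split; last by rewrite leNgt; apply/negP => /(OE _ Up).
rewrite leNgt; apply/negP => rp.
have : {for p, continuous rho} by have [] := sr [::] p Up.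
move=> /continuous_normP/(_ _ rp)[d d0 dP].
have [d' d'0 dU] := open_normP oU Up.
have [|y Oy yp] := (closureP _ _).1 cp (Num.min d d'); first by rewrite lt_min d0.
move: yp; rewrite lt_min => /andP[/dP + /dU Uy].
have := (OE _ Uy).1 Oy; rewrite ltr_norml => ry /andP[+ _].
by rewrite ltrBrDr addNr ltNge ltW.
Qed.

(** Normalizing the gradient does not affect the sign. This is the form in which the normal
    condition of star-shapedness is used from here on. *)
Lemma dot_gradient_gt0 p U rho : local_defining Omega p U rho ->
  boundary Omega p -> 0 < dot p (gradient rho p).
Proof.
move=> ld bp; have := star.2 p (normal_field rho p) bp.
move=> /(_ (ex_intro _ U (ex_intro _ rho (conj ld erefl)))).
rewrite /normal_field dotC dotZl dotC => h.
rewrite ltNge; apply/negP => h'; move: h; rewrite ltNge => /negP; apply.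
by rewrite mulr_ge0_le0 // invr_ge0 sqrtr_ge0.
Qed.

(** Along the ray [rho] vanishes at parameter 1 with positive derivative, so it changes sign there.
    The conclusion is only local; [closure_ray] makes it global. *)
Lemma ray_crosses_boundary p : boundary Omega p ->
  exists2 d : R, 0 < d & forall t : R, `|t - 1| < d ->
    (t < 1 -> Omega (t *: p)) /\ (1 < t -> ~ Omega (t *: p)).
Proof.
move=> bp; have [_ _ _ _ /(_ p bp)[U [rho ld]]] := dom.
have c0 := dot_gradient_gt0 ld bp; have r0 := local_defining0 ld bp.
have [oU Up sr _ OE] := ld.
have dr := local_defining_differentiable ld Up.
set c := dot p (gradient rho p) in c0.
have p1 : 0 < `|p| + 1 by rewrite ltr_wpDl.
have e0 : 0 < c / 2 / (`|p| + 1) by rewrite !divr_gt0.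
have [d d0 dP] := differentiable_approx dr e0.
have [d' d'0 dU] := open_normP oU Up.
have m0 : 0 < Num.min d d' by rewrite lt_min d0.
exists (Num.min d d' / (`|p| + 1)) => [|t]; first by rewrite divr_gt0.
rewrite ltr_pdivlMr // => tp.
have tE : t *: p - p = (t - 1) *: p by rewrite scalerBl scale1r.
have : `|t *: p - p| < Num.min d d'.
  rewrite tE normrZ; apply: le_lt_trans tp.
  by rewrite ler_wpM2l // lerDl.
rewrite lt_min => /andP[/dP + /dU Ut].
rewrite r0 subr0 tE dotZl normrZ -/c => h.
have {}h : `|rho (t *: p) - (t - 1) * c| <= c / 2 * `|t - 1|.
  apply: le_trans h _; rewrite -!mulrA ler_wpM2l ?(ltW c0) //.
  rewrite ler_wpM2l ?invr_ge0 // mulrCA ler_piMr // ler_pdivrMl // mulr1.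
  by rewrite lerDl.
have [rn rp] := ray_sign h c0.
split=> [/rn /(OE _ Ut) //|/rp r_gt0 /(OE _ Ut)].
by rewrite ltNge ltW.
Qed.

(** Let [m] be the supremum of the parameters in [0, 1) whose point lies outside [Omega]. Openness
    keeps [m *: x] outside, while the parameters just above [m] are good, or [m] is 1 and [x] itself
    is in the closure; so [m *: x] is a boundary point, against the crossing direction. *)
Lemma closure_ray x s : closure Omega x -> 0 <= s < 1 -> Omega (s *: x).
Proof.
move=> cx /andP[s0 s1]; apply: contrapT => nOs.
pose S := [set t : R | 0 <= t < 1 /\ ~ Omega (t *: x)].
have Ss : S s by split=> //; rewrite s0 s1.
have supS : has_sup S.
  by split; [exists s|exists 1 => t [/andP[_ /ltW]]].
set m := sup S; have m1 : m <= 1.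
  by apply: ge_sup; [exists s|move=> t [/andP[_ /ltW]]].
have ubS t : S t -> t <= m by move=> St; exact: sup_upper_bound.
have nOm : ~ Omega (m *: x).
  move=> Om; have [d d0 dP] := open_normP Omega_open Om.
  have x1 : 0 < `|x| + 1 by rewrite ltr_wpDl.
  have [t St mt] := sup_adherent (divr_gt0 d0 x1) supS.
  have [_ nOt] := St; apply: nOt; apply: dP.
  rewrite -scalerBl normrZ distrC ger0_norm ?subr_ge0 ?ubS //.
  rewrite -/m in mt; have : (m - t) * (`|x| + 1) < d.
    by rewrite -ltr_pdivlMr // ltrBlDr -ltrBlDl.
  by apply: le_lt_trans; rewrite ler_wpM2l ?subr_ge0 ?ubS // lerDl.
have m0 : 0 < m.
  rewrite lt_neqAle (le_trans s0 (ubS _ Ss)) andbT; apply/eqP => mE.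
  by apply: nOm; rewrite -mE scale0r; exact: Omega0.
have near_m t : m < t -> t < 1 -> Omega (t *: x).
  move=> mt t1; apply: contrapT => nO; move: (mt); rewrite ltNge => /negP; apply.
  by apply: ubS; split=> //; rewrite t1 andbT; exact: ltW (lt_trans m0 mt).
have bm : boundary Omega (m *: x).
  apply/boundaryP; split=> //.
  have [m_lt1|m_ge1] := ltP m 1; last first.
    by have -> : m = 1 by [apply/le_anti; rewrite m1]; rewrite scale1r.
  apply/closureP => d d0.
  have x1 : 0 < `|x| + 1 by rewrite ltr_wpDl.
  pose e := Num.min (d / (`|x| + 1)) ((1 - m)) / 2.
  have e0 : 0 < e by rewrite divr_gt0 // lt_min subr_gt0 m_lt1 divr_gt0.
  have e2 : e < Num.min (d / (`|x| + 1)) (1 - m).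
    by rewrite /e ltr_pdivrMr // ltr_pMr ?ltr1n // lt_min subr_gt0 m_lt1 divr_gt0.
  move: e2; rewrite lt_min => /andP[ed em].
  exists ((m + e) *: x).
    by apply: near_m; rewrite ?ltrDl // -ltrBrDl.
  rewrite -scalerBl [m + e]addrC addrK normrZ gtr0_norm //.
  move: ed; rewrite ltr_pdivlMr //; apply: le_lt_trans.
  by rewrite ler_wpM2l ?(ltW e0) // lerDl.
have [d d0 dP] := ray_crosses_boundary bm.
have scale_m t : t *: x = (t / m) *: (m *: x) by rewrite scalerA divfK ?gt_eqF.
have dist_m t : `|t - m| < d * m -> `|t / m - 1| < d.
  move=> tm; have -> : t / m - 1 = (t - m) / m by rewrite mulrBl divff ?gt_eqF.
  by rewrite normrM normfV (gtr0_norm m0) ltr_pdivrMr.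
have dm : 0 < d * m by rewrite mulr_gt0.
(* If [m < 1], points just above [m] lie in [Omega] although the ray should have left it. If
   [m = 1], bad parameters accumulate at 1 from below although the ray should still be inside. *)
have [m_lt1|m_ge1] := ltP m 1.
  pose e := Num.min (d * m) (1 - m) / 2.
  have e0 : 0 < e by rewrite divr_gt0 // lt_min subr_gt0 m_lt1 dm.
  have : e < Num.min (d * m) (1 - m).
    by rewrite /e ltr_pdivrMr // ltr_pMr ?ltr1n // lt_min subr_gt0 m_lt1 dm.
  rewrite lt_min => /andP[ed em].
  have mme : m < m + e by rewrite ltrDl.
  have dme : `|m + e - m| < d * m by rewrite [m + e]addrC addrK gtr0_norm.
  have [_ nO] := dP _ (dist_m _ dme).
  exfalso; apply: nO; first by rewrite ltr_pdivlMr // mul1r.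
  by rewrite -scale_m; apply: near_m; rewrite // -ltrBrDl.
have mE : m = 1 by apply/le_anti; rewrite m1.
have [t St mt] := sup_adherent dm supS.
have [/andP[t0 t1] nOt] := St; apply: nOt; rewrite scale_m.
have [|+ _] := dP (t / m); last by apply; rewrite mE divr1.
apply: dist_m; rewrite distrC ger0_norm ?subr_ge0 ?ubS //.
by rewrite ltrBlDr -ltrBlDl.
Qed.

(** * Level sets, homogeneity and positivity of the gauge *)

Definition gauge_set x : set R := [set s | 0 < s /\ ( *:%R s @` Omega) x].

Lemma gauge_setP x s : 0 < s -> gauge_set x s <-> Omega (s^-1 *: x).
Proof.
move=> s0; split=> [[_ [y Oy <-]]|Ox].
  by rewrite scalerA mulVf ?gt_eqF // scale1r.
by split=> //; exists (s^-1 *: x); rewrite // scalerA mulfV ?gt_eqF // scale1r.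
Qed.

Lemma Omega_ray_open x s : 0 < s -> Omega (s^-1 *: x) ->
  exists2 s', 0 < s' < s & Omega (s'^-1 *: x).
Proof.
move=> s0 Ox; have [d d0 dP] := open_normP Omega_open Ox.
pose q := s^-1 *: x.
have q1 : 0 < `|q| + 1 by rewrite ltr_wpDl.
have e0 : 0 < d / (`|q| + 1) by rewrite divr_gt0.
have e1 : 0 < 1 + d / (`|q| + 1) by rewrite addr_gt0.
exists (s / (1 + d / (`|q| + 1) / 2)).
  rewrite divr_gt0 //=; last by rewrite addr_gt0 // divr_gt0.
  rewrite ltr_pdivrMr ?ltr_pMr ?ltrDl ?divr_gt0 //.
  by rewrite addr_gt0 // divr_gt0.
apply: dP; set c := 1 + _; have cE : c - 1 = d / (`|q| + 1) / 2.
  by rewrite /c addrC addKr.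
have -> : (s / c)^-1 *: x - s^-1 *: x = (c - 1) *: q.
  by rewrite scalerBl scale1r scalerA invfM invrK mulrC.
rewrite cE normrZ gtr0_norm ?divr_gt0 //.
apply: (@le_lt_trans _ _ (d / (`|q| + 1) / 2 * (`|q| + 1))).
  by rewrite ler_wpM2l ?lerDl // divr_ge0 // ltW.
by rewrite mulrAC divfK ?gt_eqF // ltr_pdivrMr // ltr_pMr // ltr1n.
Qed.

Lemma gauge_set_nonempty x : gauge_set x !=set0.
Proof.
have [d d0 dP] := open_normP Omega_open Omega0.
have x1 : 0 < `|x| + 1 by rewrite ltr_wpDl.
have s0 : 0 < (`|x| + 1) / d by rewrite divr_gt0.
exists ((`|x| + 1) / d); apply/gauge_setP => //; apply: dP.
rewrite subr0 normrZ gtr0_norm ?invr_gt0 // ltr_pdivrMl // divfK ?gt_eqF //.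
by rewrite ltrDl.
Qed.

Lemma gauge_set_lbound x : lbound (gauge_set x) 0.
Proof. by move=> s [/ltW]. Qed.

Lemma gauge_ge0 x : 0 <= mu x.
Proof. exact: lb_le_inf (gauge_set_nonempty x) (@gauge_set_lbound x). Qed.

(** The admissible factors form an open half-line: [closure_ray] makes the set upward closed and
    [Omega_ray_open] shows that its infimum is not attained at a positive value. *)
Lemma gauge_lt x s : 0 < s -> mu x < s <-> Omega (s^-1 *: x).
Proof.
move=> s0; split=> [ms|/(Omega_ray_open s0)[s' /andP[s'0 s's] Os']].
  have [t At ts] := inf_lt (gauge_set_nonempty x) ms.
  have [t0 _] := At; have /(gauge_setP _ t0) Ot := At.
  have -> : s^-1 *: x = (t / s) *: (t^-1 *: x).
    by rewrite scalerA mulrAC mulfV ?gt_eqF // mul1r.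
  apply: closure_ray; first exact: subset_closure.
  by rewrite divr_ge0 ?(ltW t0) ?(ltW s0) //= ltr_pdivrMr // mul1r.
apply: le_lt_trans s's; apply: ge_inf; first by exists 0; exact: gauge_set_lbound.
exact/gauge_setP.
Qed.

Lemma closure_gauge x : closure Omega x <-> mu x <= 1.
Proof.
split=> [cx|m1].
  apply/ler_addgt0Pr => e e0; have e1 : 0 < 1 + e by rewrite addr_gt0.
  apply/ltW/(gauge_lt _ e1)/closure_ray => //.
  by rewrite invr_ge0 ltW //= invf_lt1 // ltrDl.
apply/closureP => d d0.
have x1 : 0 < `|x| + 1 by rewrite ltr_wpDl.
have e0 : 0 < d / (`|x| + 1) by rewrite divr_gt0.
have e1 : 0 < 1 + d / (`|x| + 1) by rewrite addr_gt0.
exists ((1 + d / (`|x| + 1))^-1 *: x).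
  by apply/(gauge_lt _ e1); apply: le_lt_trans m1 _; rewrite ltrDl.
have -> : (1 + d / (`|x| + 1))^-1 *: x - x = ((1 + d / (`|x| + 1))^-1 - 1) *: x.
  by rewrite scalerBl scale1r.
rewrite normrZ distrC ger0_norm; last first.
  by rewrite subr_ge0 invf_le1 // lerDl ltW.
apply: (@le_lt_trans _ _ (d / (`|x| + 1) * `|x|)).
  rewrite ler_wpM2r // -[X in X - _](divff (lt0r_neq0 e1)) -[X in _ - X]mul1r.
  by rewrite -mulrBl addrC addKr ler_piMr ?invf_le1 ?lerDl // ltW.
by rewrite mulrAC ltr_pdivrMr // ltr_pM2l // ltrDl.
Qed.

Lemma Omega_gauge x : Omega x <-> mu x < 1.
Proof.
by have := gauge_lt x ltr01; rewrite invr1 scale1r => H; split=> /H.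
Qed.

Lemma boundary_gauge x : boundary Omega x <-> mu x = 1.
Proof.
split=> [/boundaryP[/closure_gauge m1 nO]|m1].
  by apply/le_anti; rewrite m1 leNgt; apply/negP => /Omega_gauge.
apply/boundaryP; split; first by apply/closure_gauge; rewrite m1.
by move/Omega_gauge; rewrite m1 ltxx.
Qed.

Lemma gaugeZ t x : 0 < t -> mu (t *: x) = t * mu x.
Proof.
move=> t0.
have E s : 0 < s -> (mu (t *: x) < s) = (t * mu x < s).
  move=> s0; have st : 0 < s / t by rewrite divr_gt0.
  have S : s^-1 *: (t *: x) = (s / t)^-1 *: x.
    by rewrite scalerA invfM invrK.
  apply/idP/idP => [/(gauge_lt _ s0)|].
    by rewrite S => /(gauge_lt _ st); rewrite ltr_pdivlMr // mulrC.
  by rewrite mulrC -ltr_pdivlMr // => /(gauge_lt _ st); rewrite -S => /(gauge_lt _ s0).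
have m0 := gauge_ge0 x; have m1 := gauge_ge0 (t *: x).
have m2 : 0 <= t * mu x by rewrite mulr_ge0 // ltW.
apply/le_anti/andP; split; apply/ler_addgt0Pr => e e0.
  by apply/ltW; rewrite E ?ltrDl // ltr_wpDl.
by apply/ltW; rewrite -E ?ltrDl // ltr_wpDl.
Qed.

(** Boundedness of [Omega]: a vanishing gauge would put the point of norm [M + M] on the ray of [x]
    into a set bounded by [M]. *)
Lemma gauge_gt0 x : x != 0 -> 0 < mu x.
Proof.
move=> x0; rewrite lt_neqAle gauge_ge0 andbT eq_sym; apply/negP => /eqP m0.
have [M M0 MP] : exists2 M : R, 0 < M & forall y, Omega y -> `|y| <= M.
  have [_ _ _ [M [_ MP]] _] := dom; exists (`|M| + 1); first by rewrite ltr_wpDl.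
  by move=> y /(MP (`|M| + 1)); apply; rewrite (le_lt_trans (ler_norm M)) // ltrDl.
have nx : 0 < `|x| by rewrite normr_gt0.
have s0 : 0 < `|x| / (M + M) by rewrite divr_gt0 // addr_gt0.
have : mu x < `|x| / (M + M) by rewrite m0.
move=> /(gauge_lt _ s0) /MP; rewrite normrZ gtr0_norm ?invr_gt0 //.
rewrite invfM invrK mulrAC mulVf ?gt_eqF // mul1r.
by rewrite gerDl leNgt M0.
Qed.

(** * Radial projection to the boundary, and regularity of the gauge *)

Let rad x := (mu x)^-1 *: x.

Lemma boundary_rad x : x != 0 -> boundary Omega (rad x).
Proof.
move=> x0; apply/boundary_gauge; rewrite gaugeZ ?invr_gt0 ?gauge_gt0 //.
by rewrite mulVf // gt_eqF // gauge_gt0.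
Qed.

Lemma exterior_gauge x : ~ closure Omega x -> 1 < mu x.
Proof. by move=> nc; rewrite ltNge; apply/negP => /closure_gauge. Qed.

Lemma exterior_neq0 x : ~ closure Omega x -> x != 0.
Proof.
by move=> nc; apply/eqP => x0; apply: nc; rewrite x0; apply: subset_closure; exact: Omega0.
Qed.

Lemma boundary_neq0 x : boundary Omega x -> x != 0.
Proof. by move=> /boundaryP[_ nO]; apply/eqP => x0; apply: nO; rewrite x0; exact: Omega0. Qed.

Lemma gauge_continuous x : x != 0 -> {for x, continuous mu}.
Proof.
move=> x0; have m0 := gauge_gt0 x0; apply/continuous_normP => e e0.
have scale_near s (A : set 'rV[R]_n) : 0 < s -> open A -> A (s^-1 *: x) ->
    exists2 d : R, 0 < d & forall y, `|y - x| < d -> A (s^-1 *: y).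
  move=> s0 oA As; have [d d0 dP] := open_normP oA As.
  exists (d * s) => [|y yx]; first by rewrite mulr_gt0.
  apply: dP; rewrite -scalerBr normrZ gtr0_norm ?invr_gt0 //.
  by rewrite ltr_pdivrMl // mulrC.
have me0 : 0 < mu x + e by rewrite addr_gt0.
have [|d1 d10 dP1] := scale_near _ _ me0 Omega_open.
  by apply/gauge_lt; rewrite // ltrDl.
(* The lower bound uses that the complement of the closure is open; the maximum keeps the scaling
   factor positive when [e] is large. *)
pose s := Num.max (mu x - e) (mu x / 2).
have s0 : 0 < s by rewrite lt_max divr_gt0 ?orbT.
have sm : s < mu x.
  by rewrite gt_max gtrBl e0 ltr_pdivrMr // ltr_pMr ?ltr1n.
have oC : open (~` closure Omega) by apply: closed_openC; exact: closed_closure.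
have [|d2 d20 dP2] := scale_near _ _ s0 oC.
  move=> /closure_gauge; rewrite gaugeZ ?invr_gt0 // ler_pdivrMl // mulr1.
  by rewrite leNgt sm.
exists (Num.min d1 d2) => [|y]; first by rewrite lt_min d10.
rewrite lt_min => /andP[/dP1 /(gauge_lt _ me0) y1 /dP2 y2].
have y3 : s < mu y.
  rewrite ltNge; apply/negP => ys; apply: y2; apply/closure_gauge.
  by rewrite gaugeZ ?invr_gt0 // ler_pdivrMl // mulr1.
rewrite ltr_norml ltrBlDl y1 andbT ltrBrDl; apply: le_lt_trans y3.
by rewrite le_max lexx.
Qed.

Lemma continuous_inv_gauge x : x != 0 -> {for x, continuous (fun y => (mu y)^-1)}.
Proof.
by move=> x0; exact: (cvgV (lt0r_neq0 (gauge_gt0 x0)) (gauge_continuous x0)).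
Qed.

Lemma rad_entry x j : rad x 0 j = x 0 j * (mu x)^-1.
Proof. by rewrite mxE mulrC. Qed.

Lemma rad_continuous x : x != 0 -> {for x, continuous rad}.
Proof.
move=> x0; apply: continuous_rV => j.
rewrite [X in {for x, continuous X}](_ : _ = fun y : 'rV[R]_n => y 0 j * (mu y)^-1).
  exact: (cvgM (@coord_continuous R 1 n 0 j x) (continuous_inv_gauge x0)).
by apply/funext => y; exact: rad_entry.
Qed.

(* The implicit function theorem for rho (y / mu y) = 0, at first order. *)
Lemma gauge_differentiable x U rho : x != 0 ->
  local_defining Omega (rad x) U rho ->
  differentiable mu x /\
  gradient mu x = (dot (rad x) (gradient rho (rad x)))^-1 *: gradient rho (rad x).
Proof.
move=> x0 ld; have m0 := gauge_gt0 x0.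
have bx := boundary_rad x0; have c0 := dot_gradient_gt0 ld bx.
have [oU Ux _ _ _] := ld; have drho := local_defining_differentiable ld Ux.
have r0 := local_defining0 ld bx.
set q := rad x in c0 *; set g := gradient rho q in c0 *; set c := dot q g in c0 *.
have qE : x = mu x *: q by rewrite scalerA mulfV ?gt_eqF // scale1r.
apply: approx_differentiable => e e0.
have Kg0 : 0 <= n%:R * `|g| by rewrite mulr_ge0.
have [eta eta0 etaP] := implicit_step_eta Kg0 (normr_ge0 q) c0 e0.
have [d1 d10 dP1] := differentiable_approx drho eta0.
have [d2 d20 dU] := open_normP oU Ux.
have d120 : 0 < Num.min d1 d2 by rewrite lt_min d10.
have /near_normP[d3 d30 dP3] : \forall y \near x, `|rad y - q| < Num.min d1 d2.
  have /cvgrPdist_lt/(_ _ d120) := rad_continuous x0.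
  by apply: filterS => y; rewrite distrC.
have /near_normP[d4 d40 dP4] : \forall y \near x, y != 0.
  apply/near_normP; exists `|x| => [|y yx]; first by rewrite normr_gt0.
  by apply: contraTneq yx => ->; rewrite sub0r normrN ltxx.
exists (Num.min d3 d4) => [|y]; first by rewrite lt_min d30.
rewrite lt_min => /andP[/dP3 + /dP4 y0]; rewrite lt_min => /andP[/dP1 rq /dU Uy].
have my0 := gauge_gt0 y0.
rewrite (local_defining0 (local_defining_at ld Uy) (boundary_rad y0)) r0 in rq.
(* Multiplying by [mu y] makes the displacement of the projection affine in the increment of [mu].
   Since [rho] vanishes at both [rad y] and [q], its first-order expansion becomes an estimate for
   that increment. *)
have E : mu y *: (rad y - q) = (y - x) - (mu y - mu x) *: q.
  rewrite scalerBr scalerA mulfV ?gt_eqF // scale1r scalerBl -qE opprB.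
  by rewrite addrA subrK.
have dE : mu y * dot (rad y - q) g = dot (y - x) g - (mu y - mu x) * c.
  by rewrite -dotZl E dotBl dotZl.
have nE : mu y * `|rad y - q| <= `|y - x| + `|mu y - mu x| * `|q|.
  rewrite -{1}[mu y](gtr0_norm my0) -normrZ E (le_trans (ler_normB _ _)) //.
  by rewrite normrZ.
have h1 : `|dot (y - x) g - (mu y - mu x) * c| <=
    eta * (`|y - x| + `|mu y - mu x| * `|q|).
  rewrite -dE normrM (gtr0_norm my0) (le_trans _ (ler_wpM2l (ltW eta0) nE)) //.
  rewrite mulrCA ler_pM2l //; move: rq.
  by rewrite !subr0 sub0r normrN.
have h2 : `|dot (y - x) g| <= n%:R * `|g| * `|y - x|.
  by rewrite mulrAC; exact: normr_dot_le.
have -> : dot (y - x) (c^-1 *: g) = c^-1 * dot (y - x) g.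
  by rewrite dotC dotZl [dot g _]dotC.
exact: (etaP _ _ _ (normr_ge0 (y - x)) h1 h2).
Qed.

Let nonzero : set 'rV[R]_n := [set x | x != 0].

Lemma open_nonzero : open nonzero.
Proof.
rewrite openE => x /= x0.
suff : \forall y \near x, y != 0 by [].
apply/near_normP; exists `|x| => [|y yx]; first by rewrite normr_gt0.
by apply: contraTneq yx => ->; rewrite sub0r normrN ltxx.
Qed.

Lemma boundary_local x : x != 0 ->
  exists U rho, local_defining Omega (rad x) U rho.
Proof. by move=> /boundary_rad bx; case: dom => _ _ _ _; apply. Qed.

Let chart U : set 'rV[R]_n := [set x | x != 0 /\ U (rad x)].

Lemma open_chart U : open U -> open (chart U).
Proof.
move=> oU; rewrite openE => x /= [x0 Ux].
have H1 : \forall y \near x, y != 0.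
  exact: (open_nbhs_nbhs (conj open_nonzero x0)).
have H2 : \forall y \near x, U (rad y).
  by apply: (rad_continuous x0); exact: open_nbhs_nbhs.
by apply: filterS2 H1 H2 => y.
Qed.

Lemma pderiv_gauge x U rho i : x != 0 -> local_defining Omega (rad x) U rho ->
  pderiv i mu x =
    (dot (rad x) (gradient rho (rad x)))^-1 * pderiv i rho (rad x).
Proof.
move=> x0 ld; have [_ g] := gauge_differentiable x0 ld.
by rewrite pderiv_gradient g mxE pderiv_gradient.
Qed.

Lemma Cn_dot_gradient U rho m : open U -> (forall k, Cn k U rho) ->
  Cn m U (fun y => dot y (gradient rho y)).
Proof.
move=> oU rC; apply: Cn_sum => // j; apply: CnM => //; first exact: Cn_coord.
have [_ /(_ j) C] := rC m.+1.
by apply: (Cn_eq oU _ C) => y _; rewrite pderiv_gradient.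
Qed.

(** If [mu] is C^m, so is [rad], hence so is the right-hand side of the gradient formula, since
    [rho] and its derivatives are smooth. So each use of the formula gains one derivative. *)
Lemma Cn_gauge m : Cn m nonzero mu.
Proof.
elim: m => [|m IH]; first by move=> x; exact: gauge_continuous.
split=> [x x0|i].
  by have [U [rho ld]] := boundary_local x0; have [] := gauge_differentiable x0 ld.
apply: Cn_local open_nonzero _ => x x0.
have [U [rho ld]] := boundary_local x0; have [oU Ux sr _ _] := ld.
have rC := (smooth_onP _ oU).1 sr; have oV := open_chart oU.
exists (chart U); split=> //.
have VW : chart U `<=` nonzero by move=> y [].
have YC j : Cn m (chart U) (fun y => rad y 0 j).
  have C := CnM oV (Cn_coord m j oV)
    (CnV oV (fun y Vy => lt0r_neq0 (gauge_gt0 Vy.1)) (Cn_sub VW IH)).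
  by apply: (Cn_eq oV _ C) => y _; rewrite rad_entry.
have VU y : chart U y -> U (rad y) by case.
have C1 := Cn_comp oV VU YC (Cn_dot_gradient m oU rC).
have [_ /(_ i) C2] := rC m.+1.
have D0 y : chart U y -> dot (rad y) (gradient rho (rad y)) != 0.
  move=> [y0 Uy]; apply: lt0r_neq0.
  exact: dot_gradient_gt0 (local_defining_at ld Uy) (boundary_rad y0).
apply: (Cn_eq oV _ (CnM oV (CnV oV D0 C1) (Cn_comp oV VU YC C2))) => y [y0 Uy].
by rewrite (pderiv_gauge _ y0 (local_defining_at ld Uy)).
Qed.

(** * Homogeneity and symmetry of the derivatives of the gauge *)

Lemma rad_scale t x : 0 < t -> rad (t *: x) = rad x.
Proof.
move=> t0; rewrite /rad gaugeZ // scalerA; congr (_ *: x).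
by rewrite invfM mulrAC mulVf ?gt_eqF // mul1r.
Qed.

Lemma scaled_neq0 t x : 0 < t -> x != 0 -> t *: x != 0.
Proof. by move=> t0 x0; rewrite scaler_eq0 negb_or gt_eqF. Qed.

Lemma pderiv_gauge_scale t x i : 0 < t -> x != 0 ->
  pderiv i mu (t *: x) = pderiv i mu x.
Proof.
move=> t0 x0; have tx0 := scaled_neq0 t0 x0.
have [U [rho ld]] := boundary_local x0.
rewrite (pderiv_gauge i x0 ld) (@pderiv_gauge _ U rho) ?rad_scale //.
Qed.

(** Differentiates the degree-0 homogeneity of the first derivatives. With [t] equal to [(mu x)^-1]
    it moves the Hessian to the boundary. *)
Lemma pderiv2_gauge_scale t x i j : 0 < t -> x != 0 ->
  pderiv i (pderiv j mu) x = t * pderiv i (pderiv j mu) (t *: x).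
Proof.
move=> t0 x0; have [_ /(_ j) [dj _]] := Cn_gauge 2.
have E : \forall y \near x, pderiv j mu y = pderiv j mu (t *: y).
  have : \forall y \near x, y != 0.
    exact: (open_nbhs_nbhs (conj open_nonzero x0)).
  by apply: filterS => y y0; rewrite pderiv_gauge_scale.
rewrite (pderiv_near_eq i E).
have coordE k : (fun y : 'rV[R]_n => (t *: y) 0 k) = (fun y => t * y 0 k).
  by apply/funext => y; rewrite mxE.
have dc k : differentiable (fun y : 'rV[R]_n => y 0 k) x by exact: differentiable_coord.
have dk k : differentiable (fun y : 'rV[R]_n => (t *: y) 0 k) x.
  by rewrite coordE; exact: differentiableZ (dc k).
have [_ ->] := pderiv_comp (dj _ (scaled_neq0 t0 x0)) dk.
rewrite (bigD1 i) //= big1 ?addr0 => [|k ki]; rewrite coordE.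
  rewrite [pderiv i (fun y => t * _) x](_ : _ = t * (i == i)%:R).
    by rewrite eqxx mulr1 mulrC.
  rewrite (pderivM _ (differentiable_cst _ _) (dc i)) pderiv_coord.
  by rewrite /pderiv derive_cst mulr0 addr0.
rewrite (pderivM _ (differentiable_cst _ _) (dc k)) pderiv_coord.
by rewrite /pderiv derive_cst eq_sym (negPf ki) !mulr0 addr0 mulr0.
Qed.

Lemma hessian_gaugeT x : x != 0 -> (hessian mu x)^T = hessian mu x.
Proof.
move=> x0; apply/matrixP => i j; rewrite !mxE.
have [d1 dC] := Cn_gauge 3.
have H : \forall y \near x, y != 0.
  exact: (open_nbhs_nbhs (conj open_nonzero x0)).
apply: pderivC.
- apply: filterS H => y y0; split.
  + exact/diff_derivable/d1.
  + exact/diff_derivable/d1.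
  + by have [d2 _] := dC i; exact/diff_derivable/d2.
  + by have [d2 _] := dC j; exact/diff_derivable/d2.
- by have [_ /(_ j) [d2 _]] := dC i; exact/differentiable_continuous/d2.
- by have [_ /(_ i) [d2 _]] := dC j; exact/differentiable_continuous/d2.
Qed.

(** * The Hessian of the gauge and the shape operator of the boundary *)

Lemma rad_boundary p : boundary Omega p -> rad p = p.
Proof. by move=> /boundary_gauge mp; rewrite /rad mp invr1 scale1r. Qed.

Lemma rad_entry_pderiv p i k : boundary Omega p ->
  differentiable (fun y => rad y 0 k) p /\
  pderiv i (fun y => rad y 0 k) p = (i == k)%:R - p 0 k * pderiv i mu p.
Proof.
move=> bp; have p0 := boundary_neq0 bp; have mp := (boundary_gauge p).1 bp.
have [dmu _] := Cn_gauge 1; have m0 := lt0r_neq0 (gauge_gt0 p0).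
have -> : (fun y => rad y 0 k) = (fun y => y 0 k * (mu y)^-1).
  by apply/funext => y; rewrite rad_entry.
have dk : differentiable (fun y : 'rV[R]_n => y 0 k) p by exact: differentiable_coord.
have dV := differentiableV (dmu p p0) m0.
split; first exact: differentiableM dk dV.
rewrite (pderivM _ dk dV) (pderivV _ (dmu p p0) m0) pderiv_coord mp invr1.
by rewrite !mul1r mulN1r mulrN addrC.
Qed.

Lemma gradient_gauge_boundary p U rho : boundary Omega p ->
  local_defining Omega p U rho ->
  gradient mu p = (dot p (gradient rho p))^-1 *: gradient rho p.
Proof.
move=> bp ld; have p0 := boundary_neq0 bp; have ld' := ld.
by rewrite -(rad_boundary bp) in ld'; have [_] := gauge_differentiable p0 ld';
  rewrite rad_boundary.
Qed.

(** Near [p] the gradient of [rho] at [rad x] equals [c x] times the gradient of [mu] at [x]; this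
    identity is differentiated once at [p]. *)
Lemma hessian_defining p U rho : boundary Omega p ->
  local_defining Omega p U rho ->
  exists a b : 'rV[R]_n, hessian rho p =
    dot p (gradient rho p) *: hessian mu p
    + a^T *m gradient mu p + (gradient mu p)^T *m b.
Proof.
move=> bp ld; have p0 := boundary_neq0 bp; have [oU Up sr _ _] := ld.
have rp := rad_boundary bp; have rC := (smooth_onP _ oU).1 sr.
pose c x := dot (rad x) (gradient rho (rad x)).
have [_ dmu2] := Cn_gauge 2.
have [_ drho2] := rC 2%N.
have drho j : differentiable (pderiv j rho) (rad p).
  by rewrite rp; have [d _] := drho2 j; exact: d.
have dY k : differentiable (fun y => rad y 0 k) p.
  by have [] := rad_entry_pderiv k k bp.
have dc : differentiable c p.
  have [d _] := Cn_dot_gradient 1 oU rC.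
  by have [] := pderiv_comp (d _ (eq_ind_r U Up rp)) dY.
have E j : \forall x \near p, pderiv j rho (rad x) = c x * pderiv j mu x.
  have : \forall x \near p, chart U x.
    by apply: (open_nbhs_nbhs (conj (open_chart oU) _)); split; rewrite ?rp.
  apply: filterS => x [x0 Ux]; have ld' := local_defining_at ld Ux.
  rewrite (pderiv_gauge j x0 ld') mulrA divff ?mul1r // lt0r_neq0 //.
  exact: dot_gradient_gt0 ld' (boundary_rad x0).
(* The first vector comes from differentiating the factor [c]; the second, the Hessian of [rho]
   applied to [p], comes from the denominator of [rad]. *)
exists (gradient c p), (\row_j \sum_k pderiv k (pderiv j rho) p * p 0 k).
apply/matrixP => i j; rewrite !mxE !big_ord_recl !big_ord0 !mxE !addr0.
have [_ /(_ i) L] := pderiv_comp (drho j) dY.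
have [dj _] := dmu2 j.
have {}L : pderiv i (fun y => pderiv j rho (rad y)) p = pderiv i (pderiv j rho) p -
    (\sum_k pderiv k (pderiv j rho) p * p 0 k) * pderiv i mu p.
  rewrite L rp; under eq_bigr do rewrite (rad_entry_pderiv i _ bp).2.
  exact: (sum_delta_sub (fun k => pderiv k (pderiv j rho) p) (fun k => p 0 k)).
have Ei := pderiv_near_eq i (E j); rewrite L (pderivM _ dc (dj _ p0)) in Ei.
rewrite /c rp in Ei.
exact: hessian_entry Ei.
Qed.

(** Product rule: differentiating the normalizing factor yields only a term along the gradient,
    invisible to tangent vectors. *)
Lemma jacobian_normal_field p U rho : local_defining Omega p U rho ->
  exists (s : R) (a : 'rV[R]_n), 0 < s /\
    'J (normal_field rho) p = s *: hessian rho p + a^T *m gradient rho p.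
Proof.
move=> ld; have [oU Up sr /(_ p Up) g0 _] := ld.
have rC := (smooth_onP _ oU).1 sr.
have dr j : differentiable (pderiv j rho) p.
  by have [_ /(_ j) [d _]] := rC 2%N; exact: d.
pose G y := dot (gradient rho y) (gradient rho y).
have dG : differentiable G p.
  have : Cn 1 U G.
    apply: Cn_sum => // j; have C : Cn 1 U (pderiv j rho) := (rC 2%N).2 j.
    by apply: (Cn_eq oU _ (CnM oU C C)) => y _; rewrite !pderiv_gradient.
  by case=> d _; exact: d.
have Gp : 0 < G p by exact: dot_gt0.
pose S y := (Num.sqrt (G y))^-1.
have sp : Num.sqrt (G p) != 0 by rewrite sqrtr_eq0 -ltNge.
have dsqrt : differentiable (Num.sqrt : R -> R) (G p).
  by apply/derivable1_diffP; have [] := is_derive1_sqrt Gp.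
have dS : differentiable S p := differentiableV (differentiable_comp dG dsqrt) sp.
have entry j : (fun y => normal_field rho y 0 j) = (fun y => S y * pderiv j rho y).
  by apply/funext => y; rewrite !mxE.
have dN : differentiable (normal_field rho) p.
  apply: differentiable_rV => j; rewrite entry; exact: differentiableM dS (dr j).
exists (S p), (gradient S p); split; first by rewrite invr_gt0 sqrtr_gt0.
apply/matrixP => i j.
have -> : 'J (normal_field rho) p i j = pderiv i (fun y => normal_field rho y 0 j) p.
  have := deriveEjacobian (delta_mx 0 i) dN; rewrite -rowE derive_mx.
    by move=> /matrixP/(_ 0 j); rewrite !mxE.
  exact: diff_derivable.
rewrite entry (pderivM _ dS (dr j)) !mxE !big_ord_recl !big_ord0 !mxE !addr0.
by rewrite [pderiv j rho p * _]mulrC.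
Qed.

(** Two tangential congruences are chained. Their factors are the inverse length of the gradient of
    [rho] and its radial component, both positive. *)
Lemma shape_mx_gauge p U rho (B : 'M[R]_(n.-1, n)) : boundary Omega p ->
  local_defining Omega p U rho -> tangent_orthonormal_basis rho p B ->
  B *m (gradient mu p)^T = 0 /\
  exists2 l : R, 0 < l & B *m hessian mu p *m B^T = l *: shape_mx rho p B.
Proof.
move=> bp ld [BB Bg]; have c0 := dot_gradient_gt0 ld bp.
have gE := gradient_gauge_boundary bp ld.
have Bm : B *m (gradient mu p)^T = 0 by rewrite gE linearZ /= -scalemxAr Bg scaler0.
split=> //; have [s [a [s0 JE]]] := jacobian_normal_field ld.
have [a' [b' HE]] := hessian_defining bp ld.
have BJ : shape_mx rho p B = s *: (B *m hessian rho p *m B^T).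
  apply: (tangential_congruence Bg (b := 0) (a := a)).
  by rewrite mulmx0 addr0.
have BH : B *m hessian rho p *m B^T =
    dot p (gradient rho p) *: (B *m hessian mu p *m B^T).
  exact: (tangential_congruence Bm HE).
exists (s * dot p (gradient rho p))^-1; first by rewrite invr_gt0 mulr_gt0.
exact: scale_back (lt0r_neq0 (mulr_gt0 s0 c0)) BJ BH.
Qed.

(** * A uniform threshold from compactness of the boundary *)

Lemma compact_boundary : compact (boundary Omega).
Proof.
apply: bounded_closed_compact.
  have [_ _ _ [M [Mr MP]] _] := dom.
  exists (M + 1); split=> [|x xM p /boundaryP[cp _]]; first exact: num_real.
  have Mx : M < x - 1 by rewrite ltrBrDr.
  have [y Oy yp] := (closureP _ _).1 cp 1 ltr01.
  have -> : p = y - (y - p) by rewrite opprB addrC subrK.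
  apply: le_trans (ler_normB _ _) _; rewrite -[x](subrK 1).
  by apply: lerD (MP _ Mx _ Oy) (ltW yp).
have -> : boundary Omega = closure Omega `&` ~` Omega.
  by apply/seteqP; split=> x /boundaryP.
apply: closedI; first exact: closed_closure.
by apply: open_closedC; exact: Omega_open.
Qed.

Lemma hessian_gauge_continuous p a b : p != 0 ->
  {for p, continuous (fun y => hessian mu y a b)}.
Proof.
move=> p0; rewrite [X in {for p, continuous X}](_ : _ = pderiv a (pderiv b mu)).
  have C : Cn 0 nonzero (pderiv a (pderiv b mu)) := ((Cn_gauge 2).2 b).2 a.
  exact: C.
by apply/funext => y; rewrite mxE.
Qed.

Lemma shifted_hessian_continuous p c a b : p != 0 ->
  {for p, continuous (fun y =>
    (hessian mu y + c *: ((gradient mu y)^T *m gradient mu y)) a b)}.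
Proof.
move=> p0; rewrite [X in {for p, continuous X}](_ : _ = fun y =>
  hessian mu y a b + c * (pderiv a mu y * pderiv b mu y)); last first.
  by apply/funext => y; rewrite !mxE !big_ord_recl !big_ord0 !mxE addr0.
have C i : {for p, continuous (pderiv i mu)}.
  have C : Cn 0 nonzero (pderiv i mu) := (Cn_gauge 1).2 i.
  exact: C.
have H := @hessian_gauge_continuous p a b p0.
exact: (cvgD H (cvgM (cvg_cst c) (cvgM (C a) (C b)))).
Qed.

Context (k : nat) (kn : (2 <= k < n)%N).
Context (cvx : strictly_convex_boundary k.-1 Omega).

Lemma mxesym_shifted_hessian p j : boundary Omega p -> (j < k)%N ->
  exists2 w : R, 0 < w & forall c,
    mxesym j.+1 (hessian mu p + c *: ((gradient mu p)^T *m gradient mu p)) =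
    mxesym j.+1 (hessian mu p) + c * w.
Proof.
move=> bp jk; have [kappa [U [rho [B [ld tB ev]]]] Gk] := cvx bp.
have [Bm [l l0 lE]] := shape_mx_gauge bp ld tB.
have n0 : (0 < n)%N by case/andP: kn => _; exact: leq_trans.
have gm0 : gradient mu p != 0.
  rewrite (gradient_gauge_boundary bp ld) scaler_eq0 invr_eq0 negb_or.
  rewrite (gt_eqF (dot_gradient_gt0 ld bp)) /=.
  by have [_ Up _ g0 _] := ld; exact: g0.
have [BB _] := tB.
have shape_gt0 : 0 < mxesym j (shape_mx rho p B).
  (* The condition [Gamma] starts at index 1; sigma_0 is the constant 1. *)
  case: j jk => [|j] jk; first by rewrite mxesym0.
  rewrite (mxesym_eigen _ ev); apply: Gk => /=.
  by rewrite -ltnS prednK // (leq_trans _ jk).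
exists (dot (gradient mu p) (gradient mu p) * mxesym j (B *m hessian mu p *m B^T)).
  by rewrite mulr_gt0 ?dot_gt0 // lE mxesymZ mulr_gt0 ?exprn_gt0.
by move=> c; rewrite (mxesym_rank1_pred _ _ _ n0 gm0 BB Bm) mulrA.
Qed.

(** An affine function of [c] with positive slope is positive beyond its zero; that zero depends
    continuously on the boundary point and so is bounded above. *)
Lemma mxesym_shift_bound j : (j < k)%N -> exists M : R, forall p c,
  boundary Omega p -> M < c ->
  0 < mxesym j.+1 (hessian mu p + c *: ((gradient mu p)^T *m gradient mu p)).
Proof.
move=> jk; pose S c q := mxesym j.+1
  (hessian mu q + c *: ((gradient mu q)^T *m gradient mu q)).
have SW q : boundary Omega q -> 0 < S 1 q - S 0 q /\
    forall c, S c q = S 0 q + c * (S 1 q - S 0 q).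
  move=> bq; have [w w0 wE] := mxesym_shifted_hessian bq jk.
  (* The slope [w] comes from choices made separately at each point. This expression for it involves
     only [mu] and is continuous. *)
  have -> : S 1 q - S 0 q = w by rewrite /S !wE mul1r mul0r addr0 addrC addKr.
  by split=> // c; rewrite /S !wE mul0r addr0.
have [->|b0] := eqVneq (boundary Omega) set0; first by exists 0 => p c [].
pose f q := - S 0 q / (S 1 q - S 0 q).
have Sc c q : boundary Omega q -> {for q, continuous (S c)}.
  move=> /boundary_neq0 q0; apply: mxesym_continuous => a b.
  exact: shifted_hessian_continuous.
have fc : {within boundary Omega, continuous f}.
  apply: continuous_in_subspaceT => q /set_mem bq.
  exact: (cvgM (cvgN (Sc 0 q bq))
    (cvgV (lt0r_neq0 (SW q bq).1) (cvgB (Sc 1 q bq) (Sc 0 q bq)))).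
have [m _ mP] := compact_EVT_max ((set0P _).1 b0) compact_boundary fc.
exists (f m) => p c bp; have := mP p (mem_set bp); have [w0 wE] := SW p bp.
move=> fp fc'; rewrite -/(S c p) wE.
have := le_lt_trans fp fc'; rewrite /f ltr_pdivrMr //.
by rewrite -subr_gt0 opprK addrC.
Qed.

Lemma mxesym_shift_threshold : exists2 T : R, 0 < T & forall j p c, (j < k)%N ->
  boundary Omega p -> T <= c ->
  0 < mxesym j.+1 (hessian mu p + c *: ((gradient mu p)^T *m gradient mu p)).
Proof.
suff H m : (m <= k)%N -> exists2 T : R, 0 < T & forall j p c, (j < m)%N ->
    boundary Omega p -> T <= c ->
    0 < mxesym j.+1 (hessian mu p + c *: ((gradient mu p)^T *m gradient mu p)).
  exact: H (leqnn k).
elim: m => [|m IH] mk; first by exists 1.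
have [T T0 TP] := IH (ltnW mk); have [M MP] := mxesym_shift_bound mk.
exists (Num.max T (M + 1)) => [|j p c]; first by rewrite lt_max T0.
rewrite ltnS leq_eqVlt ge_max => /predU1P[->|jm] bp /andP[Tc Mc]; last exact: TP.
by apply: MP => //; apply: lt_le_trans Mc; rewrite ltrDl.
Qed.

(** * The exponential of the gauge *)

Let Psi T x : R := (expR (T * (mu x - 1)) - 1) / T.

Lemma scaled_gauge_differentiable T x : x != 0 ->
  differentiable (fun y => T * (mu y - 1)) x /\
  forall i, pderiv i (fun y => T * (mu y - 1)) x = T * pderiv i mu x.
Proof.
move=> x0; have dmu : differentiable mu x := (Cn_gauge 1).1 x x0.
have dm1 := differentiableB dmu (differentiable_cst (1 : R) x).
split=> [|i]; first exact: differentiableM (differentiable_cst T x) dm1.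
rewrite (pderivM _ (differentiable_cst T x) dm1).
rewrite (pderivD _ dmu (differentiable_cst (-1 : R) x)) /pderiv !derive_cst.
by rewrite mulr0 !addr0.
Qed.

Lemma pderiv_Psi T x i : T != 0 -> x != 0 ->
  pderiv i (Psi T) x = expR (T * (mu x - 1)) * pderiv i mu x.
Proof.
move=> T0 x0; have [dm mE] := scaled_gauge_differentiable T x0.
have dE := differentiable_expR dm.
have dE1 := differentiableD dE (differentiable_cst (-1 : R) x).
rewrite (pderivM _ dE1 (differentiable_cst T^-1 x)).
rewrite (pderivD _ dE (differentiable_cst (-1 : R) x)) pderiv_expR // mE.
rewrite /pderiv !derive_cst mulr0 add0r addr0.
by rewrite mulrCA mulKf.
Qed.

(** First derivatives of [mu] agree at [x] and [rad x], while second derivatives carry a factor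
    [(mu x)^-1]; pulling it out multiplies the rank-one weight by [mu x]. *)
Lemma hessian_Psi T x : T != 0 -> x != 0 ->
  hessian (Psi T) x = (expR (T * (mu x - 1)) / mu x) *:
    (hessian mu (rad x) +
     (T * mu x) *: ((gradient mu (rad x))^T *m gradient mu (rad x))).
Proof.
move=> T0 x0; have m0 := gauge_gt0 x0.
have mV : 0 < (mu x)^-1 by rewrite invr_gt0.
apply/matrixP => a b.
have -> : hessian (Psi T) x a b =
    pderiv a (fun y => expR (T * (mu y - 1)) * pderiv b mu y) x.
  rewrite mxE; apply: pderiv_near_eq.
  have : \forall y \near x, y != 0.
    exact: (open_nbhs_nbhs (conj open_nonzero x0)).
  by apply: filterS => y; exact: pderiv_Psi.
have [dm mE] := scaled_gauge_differentiable T x0.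
have db : differentiable (pderiv b mu) x := ((Cn_gauge 2).2 b).1 x x0.
rewrite (pderivM _ (differentiable_expR dm) db) (pderiv_expR _ dm) mE.
rewrite !mxE !big_ord_recl !big_ord0 !mxE addr0.
rewrite (pderiv2_gauge_scale a b mV x0) -/(rad x).
rewrite -(pderiv_gauge_scale a mV x0) -(pderiv_gauge_scale b mV x0) -/(rad x).
exact: hessian_Psi_entry (lt0r_neq0 m0).
Qed.

Lemma Psi_exterior : exists2 T : R, 0 < T &
  [/\ smooth_on (~` closure Omega) (Psi T),
      (forall x, boundary Omega x -> Psi T x = 0),
      (forall x, ~ closure Omega x -> 0 < Psi T x) &
      (forall x, ~ closure Omega x -> mxGamma k (hessian (Psi T) x))].
Proof.
have [T T0 TP] := mxesym_shift_threshold; exists T => //.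
have Tn0 := lt0r_neq0 T0.
have oE : open (~` closure Omega) by apply: closed_openC; exact: closed_closure.
split.
- apply/(smooth_onP _ oE) => m.
  have : Cn m nonzero (Psi T).
    have oW := open_nonzero.
    apply: (CnM oW _ (Cn_cst m T^-1 oW)); apply: (CnD oW _ (Cn_cst m (-1) oW)).
    apply: (Cn_expR oW); apply: (CnM oW (Cn_cst m T oW)).
    exact: (CnD oW (Cn_gauge m) (Cn_cst m (-1) oW)).
  by apply: Cn_sub => x /exterior_neq0.
- by move=> x /boundary_gauge mx; rewrite /Psi mx subrr mulr0 expR0 subrr mul0r.
- move=> x /exterior_gauge mx; rewrite divr_gt0 // subr_gt0 expR_gt1.
  by rewrite mulr_gt0 // subr_gt0.
- move=> x cx; have x0 := exterior_neq0 cx; have m1 := exterior_gauge cx.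
  have sym : (hessian (Psi T) x)^T = hessian (Psi T) x.
    rewrite hessian_Psi // linearZ linearD linearZ /= trmx_mul trmxK.
    by rewrite (hessian_gaugeT (boundary_neq0 (boundary_rad x0))).
  have [l lE] := symmetric_eigenvalue_vector sym.
  split=> //; exists l => // -[//|i] /andP[_ ik].
  rewrite -(mxesym_eigen _ lE) hessian_Psi // mxesymZ.
  have m0 := gauge_gt0 x0.
  rewrite mulr_gt0 ?exprn_gt0 ?divr_gt0 ?expR_gt0 //.
  apply: TP => //; first exact: boundary_rad.
  (* In the exterior [mu x] exceeds 1, so the weight [T * mu x] stays above the boundary threshold
     [T]. *)
  by rewrite ler_pMr // ltW.
Qed.

End StarShapedDomain.

Theorem proposition2p2 (R : realType) (n k : nat) (Omega : set 'rV[R]_n) :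
  (2 <= k < n)%N ->
  smooth_bounded_domain Omega ->
  strictly_star_shaped Omega ->
  strictly_convex_boundary k.-1 Omega ->
  exists T : R, 0 < T /\
    let E : set 'rV[R]_n := ~` closure Omega in
    let Psi := fun x : 'rV[R]_n => (expR (T * (minkowski_gauge Omega x - 1)) - 1) / T in
    [/\ smooth_on E Psi,
        (forall x, boundary Omega x -> Psi x = 0),
        (forall x, E x -> 0 < Psi x) &
        (forall x, E x -> mxGamma k (hessian Psi x))].
Proof.
move=> kn dom star cvx.
by have [T T0 TP] := Psi_exterior dom star kn cvx; exists T.
Qed.
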